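(* Let $0<n<N$ be integers and let $X_1,\ldots,X_n$ be a simple random sample of size $n$ from a collection ${\cal A}=\{a_1,\ldots,a_N\}$ of $N$ real numbers (not necessarily distinct) satisfying $$\sum_{a\in{\cal A}}a=\sum_{a\in{\cal A}}a^3=0,\qquad \sum_{a\in{\cal A}}a^2=1.$$ Let $W=\sum_{i=1}^nX_i$ and $\sigma^2=EW^2=\frac{n(N-n)}{N(N-1)}$. Then for all $h:\mathbb{R}\to\mathbb{R}$ with four bounded derivatives, $$|Eh(W/\sigma)-\Phi h|\le\frac{1}{3\sigma}C_1(N,n,{\cal A})\|h^{(3)}\|+\frac{1}{8\sigma^2}C_2(N,{\cal A})\|h^{(4)}\|,$$ where, with $\langle k\rangle=\sum_{a\in{\cal A}}a^k$, $$C_1(N,n,{\cal A})=\sqrt8\Big(\frac{\sigma^2}{4n^2}+\langle6\rangle\alpha^2+\beta^2+\gamma^2(n-1)^2+\eta^2\Big)^{1/2},\qquad C_2(N,{\cal A})=11\langle4\rangle+\frac{45}{N},$$ $$\alpha=\frac{n-1}{N(N-n)}-1,\qquad \beta=\frac{-2(n-1)}{N(N-n+1)}+\frac{n-3}{N(N-n)}-\frac1N,$$ $$\gamma=\frac{-2}{N(N-n)(N-n+1)},\qquad \eta=\frac{-N+3}{N(N-n)}.$$ Further, if $n\to\infty$ so that $n/N\to f\in(0,1)$ (with, for each $N$, a collection ${\cal A}$ of $N$ real numbers, not necessarily distinct, satisfying $\sum_{a\in{\cal A}}a=\sum_{a\in{\cal A}}a^3=0$ and $\sum_{a\in{\cal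 A}}a^2=1$), then $$|Eh(W/\sigma)-\Phi h|\le n^{-1}\{B_1\|h^{(3)}\|+B_2\|h^{(4)}\|\}(1+o(1)),$$ where $$B_1=\frac{\sqrt8}{3}\Big(\frac{f(1-f)}{4}+n^2\langle6\rangle+2\Big(\frac{f}{1-f}\Big)^2\Big)^{1/2}\big(f(1-f)\big)^{-1/2}$$ and $$B_2=\frac18\big(11n\langle4\rangle+45f\big)\big(f(1-f)\big)^{-1}.$$
   Context: A simple random sample of size $n$ from ${\cal A}=\{a_1,\ldots,a_N\}$ is a sample drawn uniformly without replacement: $(X_1,\ldots,X_n)=(a_{\pi_1},\ldots,a_{\pi_n})$ with $(\pi_1,\ldots,\pi_n)$ uniformly distributed over the $N(N-1)\cdots(N-n+1)$ vectors of distinct indices in $\{1,\ldots,N\}$. Sums over $a\in{\cal A}$ count repeated values with multiplicity. $\Phi h=Eh(Z)$ with $Z\sim\mathcal{N}(0,1)$; $\|\cdot\|$ is the supremum norm; $h$ has four bounded derivatives if $h$ is four times differentiable and $h^{(1)},\ldots,h^{(4)}$ are bounded. *)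

(* Defs.v *)
From mathcomp Require Import all_boot all_order all_algebra.
From mathcomp Require Import all_classical all_reals all_analysis.

Set Implicit Arguments.
Unset Strict Implicit.
Unset Printing Implicit Defensive.

Import Order.TTheory GRing.Theory Num.Theory.
Import numFieldNormedType.Exports.

Local Open Scope classical_set_scope.
Local Open Scope ring_scope.

(* A collection of N reals, repetitions allowed, is a family indexed by 'I_N,
   so that sums over it count values with multiplicity. *)
Definition power_sum (R : realType) (N : nat) (a : 'I_N -> R) (k : nat) : R :=
  \sum_(i < N) a i ^+ k.

(* The number N(N-1)...(N-n+1) of injective index vectors is N ^_ n.  The
   events {J = s} with s injective have total mass 1, so J is almost surely
   injective. *)
Definition simple_random_sample (R : realType) (N n : nat) (a : 'I_N -> R)
    (d : measure_display) (T : measurableType d) (P : probability T R)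
    (X : 'I_n -> {RV P >-> R}) : Prop :=
  exists J : T -> {ffun 'I_n -> 'I_N},
    [/\ forall s : {ffun 'I_n -> 'I_N}, measurable (J @^-1` [set s]),
        forall s : {ffun 'I_n -> 'I_N}, injective s ->
          P (J @^-1` [set s]) = (((N ^_ n)%:R : R)^-1)%:E
      & forall (i : 'I_n) (t : T), X i t = a (J t i)].

Definition sample_sum (R : realType) (n : nat) (d : measure_display)
    (T : measurableType d) (P : probability T R)
    (X : 'I_n -> {RV P >-> R}) (t : T) : R :=
  \sum_(i < n) X i t.

Definition sup_norm (R : realType) (g : R -> R) : R :=
  sup (range (fun x : R => `|g x|)).

(* h itself is not required to be bounded. *)
Definition four_bounded_derivatives (R : realType) (h : R -> R) : Prop :=
  (forall k : nat, (k < 4)%N -> forall x : R, derivable (h^`(k))%classic x 1) /\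
  (forall k : nat, (1 <= k <= 4)%N -> bounded_fun (h^`(k))%classic).

Definition Phi (R : realType) (h : R -> R) : \bar R :=
  'E_(normal_prob (0 : R) 1)[h]%E.

Section constants.
Variables (R : realType) (N n : nat).

(* N and n as reals: all differences below are taken in R. *)
Let rN : R := N%:R.
Let rn : R := n%:R.

Definition sigma : R := Num.sqrt (rn * (rN - rn) / (rN * (rN - 1))).

Definition alpha : R := (rn - 1) / (rN * (rN - rn)) - 1.

Definition beta : R :=
  - 2 * (rn - 1) / (rN * (rN - rn + 1)) + (rn - 3) / (rN * (rN - rn)) - rN^-1.

Definition gamma : R := - 2 / (rN * (rN - rn) * (rN - rn + 1)).

Definition eta : R := (- rN + 3) / (rN * (rN - rn)).

Definition C1 (a : 'I_N -> R) : R :=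
  Num.sqrt 8 *
  Num.sqrt (sigma ^+ 2 / (4 * rn ^+ 2) + power_sum a 6 * alpha ^+ 2
            + beta ^+ 2 + gamma ^+ 2 * (rn - 1) ^+ 2 + eta ^+ 2).

Definition C2 (a : 'I_N -> R) : R := 11 * power_sum a 4 + 45 / rN.

Definition B1 (f : R) (a : 'I_N -> R) : R :=
  Num.sqrt 8 / 3 *
  Num.sqrt (f * (1 - f) / 4 + rn ^+ 2 * power_sum a 6
            + 2 * (f / (1 - f)) ^+ 2) *
  (Num.sqrt (f * (1 - f)))^-1.

Definition B2 (f : R) (a : 'I_N -> R) : R :=
  8^-1 * (11 * rn * power_sum a 4 + 45 * f) * (f * (1 - f))^-1.

End constants.

Arguments sigma : clear implicits.
Arguments alpha : clear implicits.
Arguments beta : clear implicits.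
Arguments gamma : clear implicits.
Arguments eta : clear implicits.
Arguments C1 {R N} n a.
Arguments C2 {R N} a.
Arguments B1 {R N} n f a.
Arguments B2 {R N} n f a.

(* Main.v *)
Require Import Defs.
From mathcomp Require Import all_boot all_order all_algebra.
From mathcomp Require Import all_classical all_reals all_analysis.
From mathcomp Require Import measurable_realfun ring lra.

(** The proof is Stein's method with a zero bias coupling, written entirely with
    finite sums over subsets of the index set.

    Analytic side.  Let F be the bounded solution of F' x - x F x = h x - Phi h
    and g w = F (w / sigma) / sigma.  Then E h(W / sigma) - Phi h is the mean of
    sigma^2 g'(W) - W g(W), so everything rests on how well W satisfies the
    Gaussian integration by parts.  Differentiating the equation shows that
    u = F^(k) solves u'' - x u' - (k + 1) u = h^(k + 1); at a maximum of u one has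
    u' = 0 and u'' <= 0, whence the sup norms satisfy |F''| <= |h'''| / 3 and
    |F'''| <= |h''''| / 4 (maximum_principle, stein_equation).

    Sampling side.  Exchanging one sampled element with an unsampled one gives
    the identity sum_subset_stein: E W g(W) is an average, over (n - 1)-subsets
    T and pairs i, j outside T with weight (a_i - a_j)^2, of the difference
    quotients of g between a(T) + a_i and a(T) + a_j.  Equivalently
    E W g(W) = sigma^2 E g'(V) for V uniform between those two points.  To
    compare V with W, the set T is produced from a sample S with one element p
    to be added: the members of S among i, j are expelled and replaced by fresh
    elements (refill, refill_coupling).  Because the replacement depends on S
    only, the conditional mean of V - W given (S, p) is an explicit polynomial
    in the power sums of S, and its coefficients are exactly alpha, beta, gamma
    and eta (refill_mean_shift).  Expanding the difference quotient to second
    order around W (difference_expansion) leaves two terms: |g''| times the mean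
    absolute value of E(V - W | sample), controlled by C1, and |g'''| times half
    the mean square of V - W, controlled by C2 (sampling_stein_bound).

    Asymptotics.  The coefficients of the power sums in the constants are rational
    functions of n / N and 1 / n, continuous at (f, 0).  Their relative deviations
    from the values at (f, 0) give one factor 1 + error_xt that does not involve h
    (C1_le_B1, C2_le_B2). *)

Import Order.TTheory GRing.Theory Num.Theory.
Import numFieldNormedType.Exports.

Local Open Scope ring_scope.

Set Implicit Arguments.
Unset Strict Implicit.

(** * Taylor bounds and a maximum principle *)

Section calculus.
Local Open Scope classical_set_scope.
Local Open Scope ring_scope.
Context {R : realType}.
Implicit Types (u v : R -> R) (x y a b c : R).

Lemma second_derivative_at_max v v' (x0 l : R) :
  (forall x : R, is_derive x 1 v (v' x)) -> is_derive x0 1 v' l ->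
  (forall x, v x <= v x0) -> v' x0 = 0 -> l <= 0.
Proof.
move=> dv dv' vmax v'0; rewrite leNgt; apply/negP => l0.
have /cvgrPdist_lt/(_ _ l0) [e/= e0 He] :
    h^-1 *: ((v' \o shift x0) (h *: (1:R)) - v' x0) @[h --> 0^'] --> l.
  rewrite -(@derive_val _ _ _ _ _ _ _ dv'); exact: (@ex_derive _ _ _ _ _ _ _ dv').
have posv' h : 0 < h -> h < e -> 0 < v' (x0 + h).
  move=> h0 he.
  have := He h; rewrite /ball_/= sub0r normrN gtr0_norm// => /(_ he (lt0r_neq0 h0)).
  rewrite v'0 subr0 /GRing.scale/= mulr1 ltr_norml => /andP[_ P].
  have : 0 < h^-1 * v' (h + x0) by lra.
  by rewrite pmulr_rgt0 ?invr_gt0// addrC.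
have e2 : 0 < e / 2 by rewrite divr_gt0.
have [||c + ] := @MVT _ v v' x0 (x0 + e / 2) _ (fun x _ => dv x).
- by rewrite ltrDl.
- apply: continuous_subspaceT => x.
  by apply: differentiable_continuous; apply/derivable1_diffP.
rewrite in_itv/= => /andP[c1 c2] E.
have := vmax (x0 + e / 2); rewrite leNgt => /negP; apply.
rewrite -subr_gt0 E addrAC subrr add0r mulr_gt0//.
have -> : c = x0 + (c - x0) by ring.
apply: posv'; lra.
Qed.

(** At a maximum of u one has u' = 0 and u'' <= 0, so the differential inequality
    bounds u there.  Subtracting e (1 + x^4) forces a maximum to exist, because
    u grows at most like x^3; this changes the operator by at most 9 e, and e is
    arbitrary. *)
Lemma maximum_principle (u u' u'' : R -> R) (c M A : R) :
  0 < c -> 0 <= A ->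
  (forall x : R, is_derive x 1 u (u' x)) ->
  (forall x : R, is_derive x 1 u' (u'' x)) ->
  (forall x, - M <= u'' x - x * u' x - c * u x) ->
  (forall x, `|u x| <= A * (1 + `|x| ^+ 3)) ->
  forall x, u x <= M / c.
Proof.
move=> c0 A0 du du' ineq growth y.
pose phi (x : R) := 1 + x ^+ 4.
have phi_gt0 x : 0 < phi x by rewrite /phi ltr_wpDr// exprn_even_ge0.
suff key (e : R) : 0 < e -> u y <= e * phi y + (M + 9 * e) / c.
  apply/ler_addgt0Pl => e e0.
  pose k := phi y + 9 / c.
  have k0 : 0 < k by rewrite /k addr_gt0// divr_gt0.
  apply: le_trans (key (e / k) (divr_gt0 e0 k0)) _.
  rewrite le_eqVlt; apply/orP; left; apply/eqP; rewrite /k.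
  by field; rewrite ?gt_eqF ?mulr_gt0//=; have := phi_gt0 y; nra.
move=> e0.
pose v x := u x - e * phi x.
pose v' x := u' x - e * (4 * x ^+ 3).
have dv x : is_derive x 1 v (v' x).
  apply: is_derive_eq.
  by rewrite /v' /GRing.scale/=; ring.
have dv' x : is_derive x 1 v' (u'' x - e * (12 * x ^+ 2)).
  apply: is_derive_eq.
  by rewrite /GRing.scale/=; ring.
(* beyond b, the quartic barrier outweighs the cubic growth of u *)
pose b := 1 + (2 * A + `|u 0|) / e.
have b1 : 1 <= b by rewrite /b lerDl divr_ge0 ?(ltW e0)// addr_ge0// mulr_ge0.
have far x : b <= `|x| -> v x <= v 0.
  move=> bx.
  have x1 : 1 <= `|x| by exact: le_trans bx.
  have x31 : 1 <= `|x| ^+ 3 by rewrite exprn_ege1.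
  have := growth x; rewrite ler_norml => /andP[_ gx].
  have : - `|u 0| <= u 0 by rewrite lerNl -normrN ler_norm.
  have : (2 * A + `|u 0|) * `|x| ^+ 3 <= e * x ^+ 4.
    have -> : x ^+ 4 = `|x| * `|x| ^+ 3.
      by rewrite -exprS -normrX ger0_norm// exprn_even_ge0.
    rewrite [leRHS]mulrA; apply: ler_wpM2r => //.
    have -> : 2 * A + `|u 0| = e * (b - 1) by rewrite /b; field; rewrite gt_eqF.
    by apply: ler_wpM2l; lra.
  have : A <= A * `|x| ^+ 3 by rewrite ler_peMr.
  have : `|u 0| <= `|u 0| * `|x| ^+ 3 by rewrite ler_peMr.
  by rewrite /v /phi expr0n/=; lra.
have b0 : 0 <= b by lra.
have [x0 _ x0max] : exists2 x0 : R, x0 \in `[- b, b] &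
    forall t : R, t \in `[- b, b] -> v t <= v x0.
  apply: EVT_max; first by lra.
  apply: continuous_subspaceT => x.
  by apply: differentiable_continuous; apply/derivable1_diffP.
have vmax x : v x <= v x0.
  have [xb|xb] := leP b `|x|.
    apply: le_trans (far _ xb) _; apply: x0max.
    by rewrite in_itv/= b0 oppr_le0 b0.
  apply: x0max; rewrite in_itv/=.
  by move: (ltW xb); rewrite ler_norml.
have v'0 : v' x0 = 0.
  have := @derive1_at_max R v (x0 - 1) (x0 + 1) x0.
  move=> /(_ _ _ _ _)[]; [lra| by []|by rewrite in_itv/=; lra|by []|].
  by move=> _ <-; apply/esym/derive_val.
have v''0 := second_derivative_at_max dv (dv' x0) vmax v'0.
have : v x0 <= (M + 9 * e) / c.
  rewrite ler_pdivlMr//.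
  have u'E : u' x0 = e * (4 * x0 ^+ 3).
    by move: v'0; rewrite /v' => /eqP; rewrite subr_eq0 => /eqP.
  have : e * (12 * x0 ^+ 2 - 4 * x0 ^+ 4) <= e * 9.
    apply: ler_wpM2l; first exact: ltW.
    have : 0 <= (2 * x0 ^+ 2 - 3) ^+ 2 by rewrite sqr_ge0.
    have -> : (2 * x0 ^+ 2 - 3) ^+ 2 = 9 - (12 * x0 ^+ 2 - 4 * x0 ^+ 4) by ring.
    by lra.
  have : 0 <= c * (e * phi x0) by rewrite !mulr_ge0// ltW.
  have := ineq x0; rewrite u'E /v /phi.
  have -> : x0 * (e * (4 * x0 ^+ 3)) = e * (4 * x0 ^+ 4) by ring.
  by lra.
have := vmax y; rewrite /v; lra.
Qed.

(** For |s| <= 1 the function phi - s f is nondecreasing; s = 1 and s = -1 give the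
    two bounds. *)
Lemma increment_le (f f' phi phi' : R -> R) (a b : R) : a <= b ->
  (forall x : R, is_derive x 1 f (f' x)) ->
  (forall x : R, is_derive x 1 phi (phi' x)) ->
  (forall x, a <= x <= b -> `|f' x| <= phi' x) ->
  `|f b - f a| <= phi b - phi a.
Proof.
move=> ab df dphi dom.
have key (s : R) : `|s| <= 1 -> s * (f b - f a) <= phi b - phi a.
  move=> s1.
  have dg (x : R) : is_derive x 1 (fun t => phi t - s * f t) (phi' x - s * f' x).
    exact: is_derive_eq.
  have [|c + E] := @MVT_segment _ _ _ a b ab (fun x _ => dg x).
    apply: continuous_subspaceT => x.
    by apply: differentiable_continuous; apply/derivable1_diffP.
  rewrite in_itv/= => cab.
  have : 0 <= (phi' c - s * f' c) * (b - a).
    rewrite mulr_ge0 ?subr_ge0// (le_trans _ (dom c cab))//.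
    by rewrite (le_trans (ler_norm _))// normrM ler_piMl.
  rewrite -E; lra.
rewrite ler_norml; have := key 1; have := key (-1).
rewrite normrN normr1 => /(_ (lexx _)) + /(_ (lexx _)); lra.
Qed.

(** The quadratic majorant is integrated on either side of the origin, hence the
    split on the sign of t. *)
Lemma taylor1_le (g g' g'' : R -> R) (M w t : R) :
  (forall x : R, is_derive x 1 g (g' x)) ->
  (forall x : R, is_derive x 1 g' (g'' x)) ->
  (forall x, `|g'' x| <= M) ->
  `|g (w + t) - g w - g' w * t| <= M * t ^+ 2 / 2.
Proof.
move=> dg dg' g''M.
have lip x : `|g' (w + x) - g' w| <= M * `|x|.
  have [x0|x0] := leP 0 x.
    have := @increment_le g' g'' (fun s => M * s) (fun=> M) w (w + x).
    rewrite (ger0_norm x0); move=> /(_ _ dg' _ (fun x _ => g''M x)) H.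
    apply: le_trans (H _ _) _; [lra| |lra].
    by move=> y; apply: is_derive_eq; rewrite /GRing.scale/=; ring.
  have := @increment_le g' g'' (fun s => M * s) (fun=> M) (w + x) w.
  rewrite distrC (ltr0_norm x0); move=> /(_ _ dg' _ (fun x _ => g''M x)) H.
  apply: le_trans (H _ _) _; [lra| |lra].
  by move=> y; apply: is_derive_eq; rewrite /GRing.scale/=; ring.
pose e s := g (w + s) - g' w * s.
have de (s : R) : is_derive s 1 e (g' (w + s) - g' w).
  have d1 : is_derive s 1 (fun s => g (w + s)) (g' (w + s)).
    have := @is_derive1_comp _ g (fun s : R => w + s) s _ 1 (dg (w + s)).
    rewrite mulr1; apply.
    by apply: is_derive_eq; rewrite add0r mulr1.
  by apply: is_derive_eq; rewrite /GRing.scale/=; ring.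
have dq (c s : R) : is_derive s 1 (fun s => c * s ^+ 2 / 2) (c * s).
  by apply: is_derive_eq; rewrite /GRing.scale/=; field.
have -> : g (w + t) - g w - g' w * t = e t - e 0.
  by rewrite /e addr0; ring.
have [t0|t0] := leP 0 t.
  apply: le_trans (increment_le t0 de (dq M) _) _.
    by move=> x /andP[x0 _]; rewrite (le_trans (lip x))// ger0_norm.
  by rewrite expr0n/=; lra.
rewrite distrC; apply: le_trans (increment_le (ltW t0) de (dq (- M)) _) _.
  by move=> x /andP[_ x0]; rewrite (le_trans (lip x))// ler0_norm//; lra.
by rewrite expr0n/=; lra.
Qed.

(** Second-order expansion around w of the increment of g between w + y and w + x.
    The factor x - y keeps it meaningful for x = y, and the remainder
    x^2 + xy + y^2 is three times the mean of the squared distance from w to a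
    uniform point between w + y and w + x. *)
Lemma difference_expansion (g g' g'' g''' : R -> R) (M w x y : R) :
  (forall t : R, is_derive t 1 g (g' t)) ->
  (forall t : R, is_derive t 1 g' (g'' t)) ->
  (forall t : R, is_derive t 1 g'' (g''' t)) ->
  (forall t, `|g''' t| <= M) ->
  `|(x - y) * (g (w + x) - g (w + y)) -
     (x - y) ^+ 2 * (g' w + g'' w * ((x + y) / 2))|
  <= M / 6 * ((x - y) ^+ 2 * (x ^+ 2 + x * y + y ^+ 2)).
Proof.
move=> dg dg' dg'' g3M.
wlog yx : x y / y <= x.
  move=> H; have [/H//|/ltW/H {}H] := leP y x.
  have -> : (x - y) * (g (w + x) - g (w + y))
    = (y - x) * (g (w + y) - g (w + x)) by ring.
  rewrite -[(x - y) ^+ 2]sqrrN opprB (addrC x y).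
  by have -> : x ^+ 2 + x * y + y ^+ 2 = y ^+ 2 + y * x + x ^+ 2 by ring.
pose e s := g (w + s) - g' w * s - g'' w * s ^+ 2 / 2.
have de (s : R) : is_derive s 1 e (g' (w + s) - g' w - g'' w * s).
  have d1 : is_derive s 1 (fun s => g (w + s)) (g' (w + s)).
    have := @is_derive1_comp _ g (fun s : R => w + s) s _ 1 (dg (w + s)).
    rewrite mulr1; apply.
    by apply: is_derive_eq; rewrite add0r mulr1.
  by apply: is_derive_eq; rewrite /GRing.scale/=; field.
have dq (s : R) : is_derive s 1 (fun s => M * s ^+ 3 / 6) (M * s ^+ 2 / 2).
  by apply: is_derive_eq; rewrite /GRing.scale/=; field.
have H := increment_le yx de dq (fun s _ => taylor1_le w s dg' dg'' g3M).
have -> : (x - y) * (g (w + x) - g (w + y)) -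
     (x - y) ^+ 2 * (g' w + g'' w * ((x + y) / 2)) = (x - y) * (e x - e y).
  by rewrite /e; field.
have -> : M / 6 * ((x - y) ^+ 2 * (x ^+ 2 + x * y + y ^+ 2))
   = (x - y) * (M * x ^+ 3 / 6 - M * y ^+ 3 / 6) by field.
have xy0 : 0 <= x - y by rewrite subr_ge0.
by rewrite normrM ger0_norm// ler_wpM2l.
Qed.
End calculus.

(** * The standard Gaussian density *)

Section gaussian.
Local Open Scope classical_set_scope.
Local Open Scope ring_scope.
Context {R : realType}.
Local Notation mu := (@lebesgue_measure R).
Local Notation p := (normal_pdf (0 : R) 1).
Implicit Types (f h : R -> R) (x y : R).

Lemma normal_pdf01E x : p x = normal_peak 1 * expR (- x ^+ 2 / 2).
Proof.
by rewrite normal_pdfE ?oner_neq0// /normal_fun subr0 expr1n.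
Qed.

Lemma normal_pdf01_gt0 x : 0 < p x.
Proof. by rewrite normal_pdf01E mulr_gt0 ?expR_gt0// normal_peak_gt0 ?oner_neq0. Qed.

Lemma normal_pdf01N x : p (- x) = p x.
Proof. by rewrite !normal_pdf01E sqrrN. Qed.

Global Instance is_derive_normal_pdf01 x : is_derive x 1 p (- x * p x).
Proof.
rewrite normal_pdf01E.
have -> : p = fun x => normal_peak 1 * expR (- x ^+ 2 / 2).
  by apply/funext => y; rewrite normal_pdf01E.
have d1 : is_derive x 1 (fun x : R => - x ^+ 2 / 2) (- x).
  by apply: is_derive_eq; rewrite /GRing.scale/=; field.
have d2 := @is_derive1_comp _ expR (fun x : R => - x ^+ 2 / 2) x _ _
  (is_derive_expR (- x ^+ 2 / 2)) d1.
apply: is_derive_eq.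
by rewrite /GRing.scale/=; ring.
Qed.

Lemma continuous_normal_pdf01 : continuous p.
Proof. exact/continuous_normal_pdf/oner_neq0. Qed.

Lemma cvg_normal_pdf01 : p x @[x --> +oo%R] --> (0 : R).
Proof.
have -> : p = fun x => normal_peak 1 * expR (- (x ^+ 2 / 2)).
  by apply/funext => y; rewrite normal_pdf01E mulNr.
rewrite -[X in _ --> X](mulr0 (normal_peak 1)); apply: cvgMr.
apply: (cvg_comp (fun x => x ^+ 2 / 2) (fun x => expR (- x))); last exact: cvgr_expR.
apply: gt0_cvgMly; last exact: cvgr_expr2.
by rewrite invr_gt0.
Qed.

Lemma integral_tail_normal_pdf01 x : 0 <= x ->
  (\int[mu]_(t in `[x, +oo[) (t * p t)%:E = (p x)%:E)%E.
Proof.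
move=> x0.
have dN y : is_derive y 1 (fun t => - p t) (y * p y).
  by apply: is_derive_eq; rewrite mulNr opprK.
have cN y : {for y, continuous (fun t => - p t)}.
  by apply: differentiable_continuous; apply/derivable1_diffP.
rewrite (@ge0_continuous_FTC2y _ _ (fun t => - p t) _ 0).
- by rewrite sub0e EFinN oppeK.
- by move=> y xy; rewrite mulr_ge0 ?normal_pdf_ge0// (le_trans x0).
- apply: continuous_subspaceT => y; apply: cvgM; first exact: cvg_id.
  exact: continuous_normal_pdf01.
- by rewrite -[X in _ --> X]oppr0; apply: cvgN; exact: cvg_normal_pdf01.
- by [].
- by apply: cvg_at_right_filter; exact: cN.
- by move=> y _; rewrite derive1E derive_val.
Qed.

Lemma continuous_absM_normal_pdf01 : continuous (fun t : R => `|t| * p t).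
Proof.
move=> x; apply: cvgM; last exact: continuous_normal_pdf01.
exact: norm_continuous.
Qed.

Lemma integral_lower_tail_normal_pdf01 x : 0 <= x ->
  (\int[mu]_(t in `]-oo, (- x)%R]) (`|t| * p t)%:E = (p x)%:E)%E.
Proof.
move=> x0; rewrite ge0_integration_by_substitutionNy.
- rewrite -integral_tail_normal_pdf01//; apply: eq_integral => t.
  rewrite inE/= in_itv/= andbT => xt.
  by rewrite normal_pdf01N normrN ger0_norm// (le_trans x0).
- apply: continuous_subspaceT; exact: continuous_absM_normal_pdf01.
- by move=> t _; rewrite mulr_ge0 ?normal_pdf_ge0.
Qed.

Lemma integrable_absM_normal_pdf01 :
  mu.-integrable setT (fun t => (`|t| * p t)%:E).
Proof.
apply/integrableP; split.
  apply/measurable_EFinP; apply: continuous_measurable_fun.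
  exact: continuous_absM_normal_pdf01.
under eq_integral do rewrite gee0_abs ?lee_fin ?mulr_ge0 ?normal_pdf_ge0//.
rewrite ge0_symfun_integralT.
- rewrite -set_itvcy.
  have -> : (\int[mu]_(t in `[0%R, +oo[) (`|t| * p t)%:E)%E
      = (\int[mu]_(t in `[0%R, +oo[) (t * p t)%:E)%E.
    apply: eq_integral => t; rewrite inE/= in_itv/= andbT => t0.
    by rewrite ger0_norm.
  by rewrite integral_tail_normal_pdf01// -EFinM ltry.
- by move=> t; rewrite mulr_ge0 ?normal_pdf_ge0.
- exact: continuous_absM_normal_pdf01.
- by move=> t /=; rewrite normal_pdf01N normrN.
Qed.

(** A test function with bounded derivative grows at most linearly; this is why
    Phi h is finite. *)
Lemma integrable_linear_growth f (A B : R) : measurable_fun setT f ->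
  (forall t, `|f t| <= A + B * `|t|) ->
  mu.-integrable setT (fun t => (f t * p t)%:E).
Proof.
move=> mf fAB.
apply: (@le_integrable _ _ _ mu setT measurableT _
  (fun t => (A%:E * (p t)%:E + B%:E * (`|t| * p t)%:E)%E)).
- apply/measurable_EFinP; apply: measurable_funM => //.
  exact: measurable_normal_pdf.
- move=> t _; rewrite -!EFinM -EFinD !abse_EFin lee_fin.
  rewrite mulrA -mulrDl !normrM (ger0_norm (normal_pdf_ge0 _ _ _)).
  rewrite ler_wpM2r ?normal_pdf_ge0//.
  by rewrite (le_trans (fAB t))// ler_norm.
- apply: integrableD => //; apply: integrableZl => //.
    exact: integrable_normal_pdf.
  exact: integrable_absM_normal_pdf01.
Qed.

(** The normal law is defined through p, so p agrees almost everywhere with its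
    Radon-Nikodym derivative, for which the change of variables is known. *)
Lemma normal_prob_density f : measurable_fun setT f ->
  mu.-integrable setT (fun t => (f t * p t)%:E) ->
  (\int[normal_prob (0 : R) 1]_t (f t)%:E = \int[mu]_t (f t * p t)%:E)%E.
Proof.
move=> mf intf.
have dom := @normal_prob_dominates R 0 1.
pose rn := Radon_Nikodym_SigmaFinite.f (normal_prob (0 : R) 1) mu.
have rnE : ae_eq mu setT rn (fun t => (p t)%:E).
  apply: integral_ae_eq => //.
  - exact: Radon_Nikodym_SigmaFinite.f_integrable.
  - by apply/measurable_EFinP; exact: measurable_normal_pdf.
  - by move=> E _ mE; rewrite -Radon_Nikodym_SigmaFinite.f_integral.
have mrn : measurable_fun setT rn.
  apply: (measurable_int mu).
  exact: Radon_Nikodym_SigmaFinite.f_integrable.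
have mp : measurable_fun setT (fun t : R => (p t)%:E).
  by apply/measurable_EFinP; exact: measurable_normal_pdf.
have ge0E g : measurable_fun setT g -> (forall t, 0 <= g t)%E ->
    (\int[normal_prob (0 : R) 1]_t (g t) = \int[mu]_t (g t * (p t)%:E))%E.
  move=> mg g0; rewrite -(Radon_Nikodym_SigmaFinite.change_of_variables dom)//.
  apply: ae_eq_integral => //.
  - exact: emeasurable_funM.
  - exact: emeasurable_funM.
  - exact: ae_eqe_mul2l.
have mEf : measurable_fun setT (EFin \o f) by apply/measurable_EFinP.
have nuf : (normal_prob (0 : R) 1).-integrable setT (EFin \o f).
  apply/integrableP; split => //; rewrite ge0E//=; last first.
    by apply/measurable_EFinP; exact: measurableT_comp.
  move/integrableP : intf => [_]; apply: le_lt_trans.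
  rewrite le_eqVlt; apply/orP; left; apply/eqP; apply: eq_integral => t _.
  by rewrite /= -EFinM normrM (ger0_norm (normal_pdf_ge0 _ _ _)).
rewrite -[LHS](Radon_Nikodym_change_of_variables dom measurableT nuf).
have rdE := ae_eq_Radon_Nikodym_SigmaFinite dom measurableT.
apply: ae_eq_integral => //.
- exact: emeasurable_funM.
- exact: (measurable_int mu intf).
- move: rdE rnE; apply: filterS2 => t /= H1 H2 _.
  transitivity ((f t)%:E * rn t)%E; last by rewrite H2// EFinM.
  by congr (_ * _)%E; exact/esym/H1.
Qed.

End gaussian.

(** * Stein's equation *)

Section stein_solution.
Local Open Scope classical_set_scope.
Local Open Scope ring_scope.
Context {R : realType}.
Local Notation mu := (@lebesgue_measure R).
Local Notation p := (normal_pdf (0 : R) 1).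

(** The solution is the primitive of k p from -oo divided by p.  Beyond 1 in
    absolute value, |k t| <= (A + B) |t| and t p(t) has primitive - p(t), so both
    tails of the primitive are at most (A + B) p(x); the upper tail is reached
    from the right end because the total integral vanishes. *)
Lemma bounded_stein_solution (k : R -> R) (A B : R) :
  0 <= A -> 0 <= B -> continuous k -> (forall t, `|k t| <= A + B * `|t|) ->
  (\int[mu]_t (k t * p t) = 0)%R ->
  exists F : R -> R, (forall x : R, is_derive x 1 F (x * F x + k x)) /\
    exists C, forall x, `|F x| <= C.
Proof.
move=> A0 B0 ck kAB int0.
have mk : measurable_fun setT k by exact: continuous_measurable_fun.
have mabs : measurable_fun setT (fun t : R => `|t| * p t).
  exact: continuous_measurable_fun continuous_absM_normal_pdf01.
have intT := integrable_linear_growth mk kAB.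
have intD (D : set R) : measurable D -> mu.-integrable D (EFin \o (fun t => k t * p t)).
  by move=> mD; apply: integrableS intT.
pose I x := (\int[mu]_(t in `]-oo, x]) (k t * p t))%R.
have ckp : continuous (fun t => k t * p t).
  by move=> t; apply: cvgM; [exact: ck|exact: continuous_normal_pdf01].
have dI (x : R) : is_derive x 1 I (k x * p x).
  have := @continuous_FTC1 R (fun t => k t * p t) -oo%O x (x + 1).
  move=> /(_ _ _ _ (ckp x))[]; [by rewrite ltrDl|exact: intD|by rewrite ltNyr|].
  by move=> /derivableP + E; rewrite -derive1E E.
pose C0 := A + B.
have Ip x : 1 <= `|x| -> `|I x| <= C0 * p x.
  move=> x1.
  have dom t : 1 <= `|t| -> `|k t * p t| <= C0 * (`|t| * p t).
    move=> t1; rewrite normrM (ger0_norm (normal_pdf_ge0 _ _ _)) mulrA.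
    apply: ler_wpM2r; first exact: normal_pdf_ge0.
    apply: le_trans (kAB t) _; rewrite /C0 mulrDl lerD2r.
    by rewrite ler_peMr.
  have intabs (D : set R) : measurable D ->
      mu.-integrable D (EFin \o (fun t => C0 * (`|t| * p t))).
    move=> mD; apply: (integrableS _ _ (subsetT _)) => //.
    exact: (integrableZl _ C0 integrable_absM_normal_pdf01).
  have bound (D : set R) (l : R) : measurable D -> (forall t, D t -> 1 <= `|t|) ->
      (\int[mu]_(t in D) (`|t| * p t)%:E = l%:E)%E ->
      `|\int[mu]_(t in D) (k t * p t)|%R <= C0 * l.
    move=> mD D1 Dl.
    apply: le_trans (le_normr_Rintegral _ _) _ => //; first exact: intD.
    apply: (@le_trans _ _ (\int[mu]_(t in D) (C0 * (`|t| * p t)))%R).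
      apply: le_Rintegral => //; last by move=> t /D1; exact: dom.
      - by have := integrable_norm (intD D mD).
      - exact: intabs.
    rewrite RintegralZl//; last first.
      by apply: (integrableS _ _ (subsetT _)) => //; exact: integrable_absM_normal_pdf01.
    by rewrite /Rintegral Dl.
  have [x0|x0] := leP 0 x.
    have {}x1 : 1 <= x by rewrite ger0_norm in x1.
    have -> : I x = - (\int[mu]_(t in `]x, +oo[) (k t * p t))%R.
      apply/eqP; rewrite -addr_eq0; apply/eqP; rewrite /I.
      have := @Rintegral_itvB R (fun t => k t * p t) -oo%O +oo%O x.
      rewrite set_itvNyy => /(_ intT isT isT); rewrite int0 sub0r => <-.
      by rewrite subrr.
    rewrite normrN; apply: bound => //.
      by move=> t; rewrite /= in_itv/= andbT => xt; rewrite ger0_norm; lra.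
    rewrite integral_itv_obnd_cbnd; last first.
      by apply/measurable_EFinP; exact: measurable_funTS mabs.
    apply: etrans (integral_tail_normal_pdf01 x0); apply: eq_integral => t.
    by rewrite inE/= in_itv/= andbT => xt; rewrite ger0_norm//; lra.
  have {}x1 : 1 <= - x by rewrite ltr0_norm in x1.
  apply: bound => //.
    by move=> t; rewrite /= in_itv/= => xt; rewrite ler0_norm; lra.
  rewrite -[X in `]-oo, X]%classic]opprK integral_lower_tail_normal_pdf01; last by lra.
  by rewrite normal_pdf01N.
pose F x := I x / p x.
have p0 x : p x != 0 by rewrite gt_eqF// normal_pdf01_gt0.
have dF (x : R) : is_derive x 1 F (x * F x + k x).
  have dV := is_deriveV (p0 x) (is_derive_normal_pdf01 x).
  apply: is_derive_eq.
  by rewrite /GRing.scale/= /F; field.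
exists F; split => //.
have cF : continuous F.
  by move=> x; apply: differentiable_continuous; apply/derivable1_diffP.
have [M1 _ M1P] : exists2 c : R, c \in `[(-1)%R, 1%R] &
    forall t : R, t \in `[(-1)%R, 1%R] -> `|F t| <= `|F c|.
  apply: (@EVT_max R (fun t => `|F t|)); first lra.
  apply: continuous_subspaceT => x.
  by apply: (continuous_comp (cF x)); exact: norm_continuous.
exists (C0 + `|F M1|) => x.
have [x1|x1] := leP 1 `|x|.
  rewrite -[leLHS]addr0 lerD// /F normrM normfV (gtr0_norm (normal_pdf01_gt0 x)).
  by rewrite ler_pdivrMr ?normal_pdf01_gt0// Ip.
rewrite -[leLHS]add0r lerD ?addr_ge0// M1P// in_itv/=.
by move: (ltW x1); rewrite ler_norml.
Qed.


Lemma le_sup_norm (g : R -> R) x : bounded_fun g -> `|g x| <= sup_norm g.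
Proof.
move=> [M [_ MP]]; apply: sup_upper_bound; last by exists x.
split; first by exists `|g x|, x.
by exists (M + 1) => _ [y _ <-]; apply: MP => //; rewrite ltrDl.
Qed.

Lemma sup_norm_ge0 (g : R -> R) : bounded_fun g -> 0 <= sup_norm g.
Proof. by move=> /(@le_sup_norm g 0); exact: le_trans. Qed.

(** The maximum principle is applied to F'' and F''', which are only known to
    grow polynomially, by repeated use of the equation.  It needs two further
    derivatives, which the equation provides since h is four times
    differentiable. *)
Lemma stein_equation (h : R -> R) : four_bounded_derivatives h ->
  exists (c : R) (F F1 F2 F3 : R -> R),
  [/\ Phi h = c%:E,
      [/\ forall x : R, is_derive x 1 F (F1 x),
          forall x : R, is_derive x 1 F1 (F2 x) &
          forall x : R, is_derive x 1 F2 (F3 x)],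
      forall x, F1 x - x * F x = h x - c,
      forall x, `|F2 x| <= sup_norm (h^`(3))%classic / 3 &
      forall x, `|F3 x| <= sup_norm (h^`(4))%classic / 4].
Proof.
move=> [dh bh].
have dhk k (x : R) : (k < 4)%N ->
    is_derive x 1 (h^`(k))%classic ((h^`(k.+1))%classic x).
  by move=> k4; rewrite derive1nS derive1E; apply/derivableP; exact: dh.
have bhk k (x : R) : (1 <= k <= 4)%N ->
    `|(h^`(k))%classic x| <= sup_norm (h^`(k))%classic.
  by move=> k4; apply: le_sup_norm; exact: bh.
have d0 (x : R) : is_derive x 1 h ((h^`(1))%classic x) by exact: (dhk 0).
have ch : continuous h.
  by move=> x; apply: differentiable_continuous; apply/derivable1_diffP.
have mh : measurable_fun setT h by exact: continuous_measurable_fun.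
pose s1 := sup_norm (h^`(1))%classic; pose s2 := sup_norm (h^`(2))%classic.
have s10 : 0 <= s1 by apply: sup_norm_ge0; exact: bh.
have s20 : 0 <= s2 by apply: sup_norm_ge0; exact: bh.
have hlin x : `|h x| <= `|h 0| + s1 * `|x|.
  have dl (t : R) : is_derive t 1 (fun t => s1 * t) s1.
    by apply: is_derive_eq; rewrite /GRing.scale/= mulr1.
  rewrite -lerBlDl; apply: le_trans (lerB_dist _ _) _.
  have [x0|x0] := leP 0 x.
    have := increment_le x0 d0 dl (fun t _ => bhk 1 t isT).
    by rewrite mulr0 subr0 (ger0_norm x0).
  have := increment_le (ltW x0) d0 dl (fun t _ => bhk 1 t isT).
  by rewrite distrC mulr0 sub0r (ltr0_norm x0) mulrN.
have inth := integrable_linear_growth mh hlin.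
have [c Ec] : exists c : R, (\int[mu]_t (h t * p t)%:E = c%:E)%E.
  have := @integrable_fin_num _ _ _ mu setT measurableT _ inth.
  by move/fineK => <-; eexists.
have PhiE : Phi h = c%:E.
  by rewrite /Phi unlock normal_prob_density.
pose k x := h x - c.
have ck : continuous k by move=> x; apply: cvgB; [exact: ch|exact: cvg_cst].
pose A := `|h 0| + `|c|.
have A0 : 0 <= A by rewrite addr_ge0.
have kAB t : `|k t| <= A + s1 * `|t|.
  by apply: le_trans (ler_normB _ _) _; rewrite /A addrAC lerD2r.
have int0 : (\int[mu]_t (k t * p t) = 0)%R.
  transitivity (\int[mu]_t (h t * p t - c * p t))%R.
    by apply: eq_Rintegral => t _; rewrite mulrBl.
  rewrite RintegralB//; last exact: (integrableZl _ c (integrable_normal_pdf _ _)).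
  rewrite RintegralZl//; last exact: integrable_normal_pdf.
  by rewrite /Rintegral Ec integral_normal_pdf/= mulr1 subrr.
have [F [dF [C FC]]] := bounded_stein_solution A0 s10 ck kAB int0.
pose F1 x := x * F x + k x.
pose F2 x := x * F1 x + F x + (h^`(1))%classic x.
pose F3 x := x * F2 x + 2 * F1 x + (h^`(2))%classic x.
pose F4 x := x * F3 x + 3 * F2 x + (h^`(3))%classic x.
pose F5 x := x * F4 x + 4 * F3 x + (h^`(4))%classic x.
have dF1 (x : R) : is_derive x 1 F1 (F2 x).
  by apply: is_derive_eq; rewrite /GRing.scale/= /F2 /F1 /k ?derive1nS ?derive1n0; ring.
have d1 (x : R) := dhk 1%N x isT.
have d2 (x : R) := dhk 2%N x isT.
have d3 (x : R) := dhk 3%N x isT.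
have dF2 (x : R) : is_derive x 1 F2 (F3 x).
  by apply: is_derive_eq; rewrite /GRing.scale/= /F3 /F1 ?derive1nS ?derive1n0; ring.
have dF3 (x : R) : is_derive x 1 F3 (F4 x).
  by apply: is_derive_eq; rewrite /GRing.scale/= /F4 /F1 ?derive1nS ?derive1n0; ring.
have dF4 (x : R) : is_derive x 1 F4 (F5 x).
  by apply: is_derive_eq; rewrite /GRing.scale/= /F5 /F1 ?derive1nS ?derive1n0; ring.
pose D := A + s1 + s2 + C.
have C0 : 0 <= C by apply: le_trans (FC 0).
have D0 : 0 <= D by rewrite /D; lra.
have gF1 x : `|F1 x| <= D * (1 + 2 * `|x|).
  apply: le_trans (ler_normD _ _) _; rewrite normrM.
  have := kAB x; have : `|x| * `|F x| <= `|x| * C by rewrite ler_wpM2l.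
  have := normr_ge0 x; rewrite /D; nra.
have gF2 x : `|F2 x| <= D * (2 + `|x| + 2 * `|x| ^+ 2).
  apply: le_trans (ler_normD _ _) _; rewrite -lerBrDr.
  apply: le_trans (ler_normD _ _) _; rewrite -lerBrDr normrM.
  apply: le_trans (ler_wpM2l (normr_ge0 x) (gF1 x)) _.
  have := bhk 1%N x isT; rewrite -/s1; have := FC x.
  have : C + s1 <= 2 * D by rewrite /D; lra.
  lra.
have gF3 x : `|F3 x| <= D * (3 + 6 * `|x| + `|x| ^+ 2 + 2 * `|x| ^+ 3).
  apply: le_trans (ler_normD _ _) _; rewrite -lerBrDr.
  apply: le_trans (ler_normD _ _) _; rewrite -lerBrDr !normrM.
  apply: le_trans (ler_wpM2l (normr_ge0 x) (gF2 x)) _.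
  have := bhk 2%N x isT; rewrite -/s2; have := gF1 x.
  have : s2 <= D by rewrite /D; lra.
  rewrite (ger0_norm (_ : 0 <= 2 :> R))//; lra.
have yy (y : R) : 0 <= y -> y + y ^+ 2 <= 1 + y ^+ 3.
  move=> y0; have : 0 <= (y - 1) ^+ 2 * (y + 1) by rewrite mulr_ge0 ?sqr_ge0// addr_ge0.
  lra.
have y1 (y : R) : 0 <= y -> y <= 1 + y ^+ 3.
  by move=> y0; have := yy y y0; have := sqr_ge0 y; lra.
have y2 (y : R) : 0 <= y -> y ^+ 2 <= 1 + y ^+ 3.
  by move=> y0; have := yy y y0; lra.
have poly3 (x : R) (a0 a1 a2 a3 : R) : 0 <= a0 -> 0 <= a1 -> 0 <= a2 -> 0 <= a3 ->
  D * (a0 + a1 * `|x| + a2 * `|x| ^+ 2 + a3 * `|x| ^+ 3)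
  <= D * (a0 + a1 + a2 + a3) * (1 + `|x| ^+ 3).
  move=> a00 a10 a20 a30; rewrite -mulrA ler_wpM2l//.
  have := ler_wpM2l a10 (y1 _ (normr_ge0 x)).
  have := ler_wpM2l a20 (y2 _ (normr_ge0 x)).
  have := mulr_ge0 a00 (exprn_ge0 3 (normr_ge0 x)); lra.
have gF2' x : `|F2 x| <= D * 5 * (1 + `|x| ^+ 3).
  have := gF2 x; have := poly3 x 2 1 2 0 (ler0n R 2) ler01 (ler0n R 2) (lexx 0); lra.
have gF3' x : `|F3 x| <= D * 12 * (1 + `|x| ^+ 3).
  have := gF3 x.
  have := poly3 x 3 6 1 2 (ler0n R 3) (ler0n R 6) ler01 (ler0n R 2); lra.
have bound (u u' u'' r : R -> R) (m A' M : R) : 0 < m -> 0 <= A' ->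
   (forall x : R, is_derive x 1 u (u' x)) ->
   (forall x : R, is_derive x 1 u' (u'' x)) ->
   (forall x, u'' x = x * u' x + m * u x + r x) -> (forall x, `|r x| <= M) ->
   (forall x, `|u x| <= A' * (1 + `|x| ^+ 3)) -> forall x, `|u x| <= M / m.
  move=> m0 A'0 du du' E rM gu x.
  rewrite ler_norml; apply/andP; split; last first.
    apply: (maximum_principle m0 A'0 du du') => // t.
    by have := rM t; rewrite ler_norml => /andP[? _]; rewrite E; lra.
  rewrite lerNl.
  apply: (@maximum_principle _ (fun t => - u t) (fun t => - u' t)
            (fun t => - u'' t) m M A') => //.
  - by move=> t; have := rM t; rewrite ler_norml => /andP[_ ?]; rewrite E; lra.
  - by move=> t; rewrite normrN.
exists c, F, F1, F2, F3; split => //.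
- by move=> x; rewrite /F1 /k; ring.
- have D5 : 0 <= D * 5 by rewrite mulr_ge0.
  exact: (bound F2 F3 F4 _ 3 _ _ (ltr0n R 3) D5 dF2 dF3 (fun=> erefl)
            (fun x => bhk 3%N x isT) gF2').
- have D12 : 0 <= D * 12 by rewrite mulr_ge0.
  exact: (bound F3 F4 F5 _ 4 _ _ (ltr0n R 4) D12 dF3 dF4 (fun=> erefl)
            (fun x => bhk 4%N x isT) gF3').
Qed.

End stein_solution.

(** * Sums over the subsets of a given size *)

Section subset_sums.
Context {R : realFieldType} {I : finType}.
Implicit Types (S T U : {set I}) (i j r : I) (a b : I -> R) (m : nat).
Local Notation N := (#|I|%:R : R).

(** Pairs (T, i) with i outside T correspond to pairs (S, i) with i in S.  This
    single double counting replaces every exchangeability argument below. *)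
Lemma sum_add_remove m (G : {set I} -> I -> R) :
  \sum_(T : {set I} | #|T| == m) \sum_(i | i \notin T) G T i
  = \sum_(S : {set I} | #|S| == m.+1) \sum_(i in S) G (S :\ i) i.
Proof.
rewrite !pair_big_dep/=.
rewrite [RHS](reindex_onto (fun u : {set I} * I => (u.2 |: u.1, u.2))
                      (fun u : {set I} * I => (u.1 :\ u.2, u.2))) /=; last first.
  by move=> [S i] /= /andP[_ iS]; rewrite finset.setD1K.
apply: eq_big => [[T i]|[T i] /andP[/= _ iT]] /=; last by rewrite finset.setU1K.
rewrite finset.setU11 andbT xpair_eqE eqxx andbT.
have [iT|iT] := boolP (i \in T).
  rewrite andbF; apply/esym/negbTE/nandP; right; apply/eqP => E.
  by move: iT; rewrite -E !inE eqxx.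
by rewrite finset.setU1K// eqxx !andbT cardsU1 iT add1n eqSS.
Qed.

Lemma sum_insert m (K : {set I} -> R) :
  \sum_(U : {set I} | #|U| == m) \sum_(r | r \notin U) K (r |: U)
  = m.+1%:R * \sum_(T : {set I} | #|T| == m.+1) K T.
Proof.
rewrite (sum_add_remove m (fun U r => K (r |: U))) mulr_sumr.
apply: eq_bigr => S /eqP Sm.
rewrite (eq_bigr (fun=> K S)); last by move=> i iS; rewrite finset.setD1K.
by rewrite sumr_const Sm mulr_natl.
Qed.

Lemma exchange_notin S (G : I -> I -> R) :
  \sum_(i | i \notin S) \sum_(j | j \notin i |: S) G i j
  = \sum_(j | j \notin S) \sum_(i | i \notin j |: S) G i j.
Proof.
rewrite (exchange_big_dep (fun j => j \notin S))/=; last first.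
  by move=> i j _; rewrite !inE negb_or => /andP[].
apply: eq_bigr => j jS; apply: eq_bigl => i.
by rewrite !inE !negb_or jS andbT (eq_sym j) andbC.
Qed.

Lemma sum_notin S b : \sum_(i | i \notin S) b i = \sum_i b i - \sum_(i in S) b i.
Proof.
apply/eqP; rewrite eq_sym subr_eq eq_sym addrC; apply/eqP.
by rewrite [RHS](bigID (mem S)).
Qed.

Lemma sum_const_notin S (c : R) : \sum_(i | i \notin S) c = (N - #|S|%:R) * c.
Proof.
by rewrite (sum_notin S (fun=> c)) !sumr_const mulrBl !mulr_natl.
Qed.

Lemma sum_D1 S i b : i \in S -> \sum_(j in S :\ i) b j = \sum_(j in S) b j - b i.
Proof.
move=> iS; apply/eqP; rewrite eq_sym subr_eq; apply/eqP.
by rewrite (big_setD1 i iS)/= addrC.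
Qed.

Lemma sum_U1 S i b : i \notin S -> \sum_(j in i |: S) b j = b i + \sum_(j in S) b j.
Proof. by move=> iS; rewrite big_setU1. Qed.

Lemma sum_subset_first_moment m b : (m <= #|I|)%N ->
  N * \sum_(S : {set I} | #|S| == m) \sum_(i in S) b i
  = 'C(#|I|, m)%:R * m%:R * \sum_i b i.
Proof.
elim: m => [|m IH] mI.
  rewrite mulr0 mul0r big1 ?mulr0// => S /eqP/cards0_eq ->.
  by rewrite big_set0.
have := sum_add_remove m (fun=> b) => /= <-.
under eq_bigr do rewrite sum_notin.
rewrite sumrB sumr_const mulrBr IH; last exact: ltnW.
have -> : #|[pred S : {set I} | #|S| == m]| = 'C(#|I|, m).
  by rewrite -card_draws; apply: eq_card => S; rewrite !inE.
have := mul_bin_left #|I| m => /(congr1 (fun k => k%:R : R)).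
rewrite !natrM natrB; last exact: ltnW.
move=> E; rewrite -[in RHS](mulrC m.+1%:R) E -mulr_natl; ring.
Qed.

(** Summed over the unsampled j, (a_i - a_j) becomes (N - m) a_i + a(T); moving i
    into the sample then collects N W g(W). *)
Lemma sum_subset_stein m a (g : R -> R) : \sum_i a i = 0 ->
  \sum_(T : {set I} | #|T| == m) \sum_(i | i \notin T) \sum_(j | j \notin T)
    (a i - a j) * (g (\sum_(k in T) a k + a i) - g (\sum_(k in T) a k + a j))
  = 2 * N * \sum_(S : {set I} | #|S| == m.+1)
       (\sum_(k in S) a k) * g (\sum_(k in S) a k).
Proof.
move=> a0.
transitivity (\sum_(T : {set I} | #|T| == m) \sum_(i | i \notin T)
   2 * ((N - m%:R) * a i + \sum_(k in T) a k) * g (\sum_(k in T) a k + a i)).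
  apply: eq_bigr => T /eqP Tm; set Y := \sum_(k in T) a k.
  have E : \sum_(i | i \notin T) \sum_(j | j \notin T) (a i - a j) * g (Y + a i)
     = \sum_(i | i \notin T) ((N - m%:R) * a i + Y) * g (Y + a i).
    apply: eq_bigr => i _; rewrite -mulr_suml sumrB sum_const_notin sum_notin a0.
    by rewrite sub0r opprK Tm.
  transitivity (2 * \sum_(i | i \notin T) \sum_(j | j \notin T)
      (a i - a j) * g (Y + a i)).
    rewrite mulr2n mulrDl !mul1r.
    rewrite [X in _ = _ + X]exchange_big/= -big_split/=; apply: eq_bigr => i _.
    rewrite -big_split/=; apply: eq_bigr => j _; ring.
  by rewrite E mulr_sumr; apply: eq_bigr => i _; rewrite mulrA.
rewrite (sum_add_remove m (fun T i =>
   2 * ((N - m%:R) * a i + \sum_(k in T) a k) * g (\sum_(k in T) a k + a i))).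
rewrite mulr_sumr; apply: eq_bigr => S /eqP Sm.
set W := \sum_(k in S) a k.
transitivity (\sum_(i in S) (2 * ((N - m.+1%:R) * a i + W) * g W)).
  apply: eq_bigr => i iS; rewrite sum_D1// subrK; congr (_ * _ * _).
  by rewrite -/W -natr1; ring.
rewrite -mulr_suml -mulr_sumr big_split/= -mulr_sumr sumr_const Sm -/W -mulr_natl.
ring.
Qed.

End subset_sums.

(** * Refilling a sample around a pair of indices *)

Section refill.
Context {R : realFieldType} {I : finType}.
Variable a : I -> R.
Implicit Types (S T U : {set I}) (i j r : I) (b : I -> R) (m : nat)
  (H psi : I -> I -> R -> R).
Local Notation N := (#|I|%:R : R).
Local Notation Y := (fun S => \sum_(k in S) a k).

(** Total of psi i j d over pairs i <> j and over the refills of S around i, j,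
    each pair having total weight one: the members of S among i and j are
    expelled, as many fresh elements outside S and distinct from i, j come in,
    uniformly at random, and d is the resulting change of a(S).  The three sums
    are the cases of none, exactly one (in either order), and both of i, j in S. *)
Definition refill S psi : R :=
  \sum_(i | i \notin S) \sum_(j | j \notin i |: S) psi i j 0
  + (N - #|S|%:R - 1)^-1 *
    (\sum_(i in S) \sum_(j | j \notin S) \sum_(r | r \notin j |: S)
        (psi i j (a r - a i) + psi j i (a r - a i)))
  + ((N - #|S|%:R) * (N - #|S|%:R - 1))^-1 *
    (\sum_(i in S) \sum_(j in S :\ i) \sum_(r | r \notin S)
       \sum_(r' | r' \notin r |: S) psi i j (a r + a r' - a i - a j)).

Let offdiag T H := \sum_(i | i \notin T) \sum_(j | j \notin i |: T) H i j (Y T).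

(** With U the sample without the expelled i, the elements i, j, r are distinct
    and outside U, and may be chosen starting with r; then r |: U is an arbitrary
    m-set T avoiding i and j, obtained m times. *)
Lemma refill_one m H :
  \sum_(S : {set I} | #|S| == m) \sum_(i in S) \sum_(j | j \notin S)
     \sum_(r | r \notin j |: S) H i j (Y S + (a r - a i))
  = m%:R * \sum_(T : {set I} | #|T| == m) offdiag T H.
Proof.
case: m => [|m].
  rewrite mul0r big1// => S /eqP/cards0_eq ->; by rewrite big_set0.
pose G U i := \sum_(j | j \notin i |: U) \sum_(r | r \notin j |: (i |: U))
   H i j (Y U + a r).
transitivity (\sum_(S : {set I} | #|S| == m.+1) \sum_(i in S) G (S :\ i) i).
  apply: eq_bigr => S _; apply: eq_bigr => i iS; rewrite /G finset.setD1K//.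
  apply: eq_bigr => j _; apply: eq_bigr => r _; rewrite sum_D1//.
  by congr (H _ _ _); ring.
rewrite -sum_add_remove -sum_insert; apply: eq_bigr => U _.
rewrite /G /offdiag.
under eq_bigr do rewrite exchange_notin.
rewrite exchange_notin; apply: eq_bigr => r rU; apply: eq_bigr => i _.
rewrite finset.setUCA; apply: eq_bigr => j _.
by rewrite sum_U1// addrC.
Qed.

Lemma rotate_notin S (F : I -> I -> I -> R) :
  \sum_(x | x \notin S) \sum_(y | y \notin x |: S)
     \sum_(z | z \notin y |: (x |: S)) F x y z
  = \sum_(z | z \notin S) \sum_(x | x \notin z |: S)
     \sum_(y | y \notin x |: (z |: S)) F x y z.
Proof.
under eq_bigr do rewrite exchange_notin.
rewrite exchange_notin; apply: eq_bigr => z _; apply: eq_bigr => x _.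
by rewrite finset.setUCA.
Qed.

Lemma refill_two m H :
  \sum_(S : {set I} | #|S| == m) \sum_(i in S) \sum_(j in S :\ i)
     \sum_(r | r \notin S) \sum_(r' | r' \notin r |: S)
       H i j (Y S + (a r + a r' - a i - a j))
  = (m%:R * (m%:R - 1)) * \sum_(T : {set I} | #|T| == m) offdiag T H.
Proof.
case: m => [|m].
  rewrite mul0r mul0r big1// => S /eqP/cards0_eq ->; by rewrite big_set0.
pose G U i := \sum_(j in U) \sum_(r | r \notin i |: U)
   \sum_(r' | r' \notin r |: (i |: U)) H i j (Y U + (a r + a r' - a j)).
transitivity (\sum_(S : {set I} | #|S| == m.+1) \sum_(i in S) G (S :\ i) i).
  apply: eq_bigr => S _; apply: eq_bigr => i iS; rewrite /G finset.setD1K//.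
  apply: eq_bigr => j _; apply: eq_bigr => r _; apply: eq_bigr => r' _.
  by rewrite sum_D1//; congr (H _ _ _); ring.
rewrite -sum_add_remove /G.
case: m {G} => [|m].
  rewrite subrr mulr0 mul0r big1// => S /eqP/cards0_eq ->.
  by rewrite big1// => i _; rewrite big_set0.
pose G V j := \sum_(i | i \notin j |: V) \sum_(r | r \notin i |: (j |: V))
   \sum_(r' | r' \notin r |: (i |: (j |: V))) H i j (Y V + (a r + a r')).
transitivity (\sum_(S : {set I} | #|S| == m.+1) \sum_(j in S) G (S :\ j) j).
  apply: eq_bigr => S _; rewrite exchange_big/=.
  apply: eq_bigr => j jS; rewrite /G finset.setD1K//.
  apply: eq_bigr => i _; apply: eq_bigr => r _; apply: eq_bigr => r' _.
  by rewrite sum_D1//; congr (H _ _ _); ring.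
rewrite -sum_add_remove /G.
have -> : (m.+2%:R - 1 : R) = m.+1%:R by rewrite -[in LHS]natr1 addrK.
rewrite -mulrA mulrCA -sum_insert.
rewrite -(sum_insert m (fun U => \sum_(r | r \notin U) offdiag (r |: U) H)).
apply: eq_bigr => V _.
rewrite rotate_notin; apply: eq_bigr => r rV.
transitivity (\sum_(j | j \notin r |: V) \sum_(i | i \notin j |: (r |: V))
   \sum_(r' | r' \notin i |: (j |: (r |: V))) H i j (Y V + (a r + a r'))).
  apply: eq_bigr => j _; apply: eq_bigr => i _; apply: eq_bigl => r'.
  by rewrite !inE !negb_or andbCA; congr (_ && _); rewrite andbCA.
rewrite rotate_notin; apply: eq_bigr => r' rr'.
rewrite exchange_notin; apply: eq_bigr => i _; apply: eq_bigr => j _.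
by rewrite !sum_U1//; congr (H _ _ _); ring.
Qed.

(** Refilling a uniform m-set around i, j yields a uniform m-set avoiding i, j.
    The factor is the ratio 'C(N, m) / 'C(N - 2, m). *)
Lemma refill_coupling m H : (m.+1 < #|I|)%N ->
  \sum_(S : {set I} | #|S| == m) refill S (fun i j d => H i j (Y S + d))
  = N * (N - 1) / ((N - m%:R) * (N - m%:R - 1)) *
    \sum_(T : {set I} | #|T| == m)
       \sum_(i | i \notin T) \sum_(j | j \notin i |: T) H i j (Y T).
Proof.
move=> mI.
have mI' : (m.+1%:R : R) < N by rewrite ltr_nat.
have L0 : N - m%:R != 0 :> R.
  by rewrite gt_eqF// subr_gt0 (lt_trans _ mI')// ltr_nat.
have L1 : N - m%:R - 1 != 0 :> R.
  by rewrite gt_eqF// -addrA -opprD natr1 subr_gt0.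
pose sumT := \sum_(T : {set I} | #|T| == m) offdiag T H.
transitivity (sumT + (N - m%:R - 1)^-1 * (m%:R * sumT + m%:R * sumT)
   + ((N - m%:R) * (N - m%:R - 1))^-1 * (m%:R * (m%:R - 1) * sumT)); last first.
  by rewrite -[X in _ = _ * X]/sumT; field; rewrite L0 L1.
rewrite -refill_two.
have EH : sumT = \sum_(T : {set I} | #|T| == m) offdiag T (fun i j => H j i).
  by apply: eq_bigr => T _; rewrite /offdiag exchange_notin.
rewrite [X in m%:R * sumT + m%:R * X]EH -!refill_one -big_split/=.
rewrite !mulr_sumr -!big_split/=.
apply: eq_bigr => S /eqP Sm; rewrite /refill Sm; congr (_ + _ * _ + _).
- by apply: eq_bigr => i _; apply: eq_bigr => j _; rewrite addr0.
- rewrite -big_split/=; apply: eq_bigr => i _.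
  rewrite -big_split/=; apply: eq_bigr => j _.
  by rewrite -big_split/=.
Qed.

End refill.

(** * Conditional mean of the refill *)

Section refill_moments.
Context {R : realType} {I : finType}.
Variable a : I -> R.
Implicit Types (S T U : {set I}) (i j r : I) (m : nat)
  (psi : I -> I -> R -> R) (phi : I -> I -> R).
Local Notation N := (#|I|%:R : R).
Local Notation fill := (refill a).

Lemma refill_lin S (c : R) psi psi' :
  fill S (fun i j d => psi i j d + c * psi' i j d)
  = fill S psi + c * fill S psi'.
Proof.
rewrite /refill.
set A1 := (X in _ = X + _ + _ + _); set A2 := (X in _ = _ + _ * X + _ + _).
set A3 := (X in _ = _ + _ + _ * X + _).
set B1 := (X in _ = _ + _ * (X + _ + _)).
set B2 := (X in _ = _ + _ * (_ + _ * X + _)).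
set B3 := (X in _ = _ + _ * (_ + _ + _ * X)).
transitivity ((A1 + c * B1) + (N - #|S|%:R - 1)^-1 * (A2 + c * B2)
  + ((N - #|S|%:R) * (N - #|S|%:R - 1))^-1 * (A3 + c * B3)); last by ring.
congr (_ + _ * _ + _ * _).
- rewrite mulr_sumr -big_split/=; apply: eq_bigr => i _.
  by rewrite mulr_sumr -big_split.
- rewrite mulr_sumr -big_split/=; apply: eq_bigr => i _.
  rewrite mulr_sumr -big_split/=; apply: eq_bigr => j _.
  rewrite mulr_sumr -big_split/=; apply: eq_bigr => r _; ring.
- rewrite mulr_sumr -big_split/=; apply: eq_bigr => i _.
  rewrite mulr_sumr -big_split/=; apply: eq_bigr => j _.
  rewrite mulr_sumr -big_split/=; apply: eq_bigr => r _.
  by rewrite mulr_sumr -big_split.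
Qed.

Section room.
Variable S : {set I}.
Hypothesis room : (#|S|.+1 < #|I|)%N.
Local Notation m := (#|S|%:R : R).

Let L1 : 0 < N - m - 1.
Proof. by rewrite -addrA -opprD natr1 subr_gt0 ltr_nat. Qed.

Let L0 : 0 < N - m.
Proof. by rewrite subr_gt0 ltr_nat (ltn_trans _ room). Qed.

Lemma refill_le psi psi' : (forall i j d, psi i j d <= psi' i j d) ->
  fill S psi <= fill S psi'.
Proof.
move=> le; apply: lerD; first apply: lerD.
- by apply: ler_sum => i _; apply: ler_sum => j _.
- rewrite ler_wpM2l ?invr_ge0 ?(ltW L1)//.
  apply: ler_sum => i _; apply: ler_sum => j _; apply: ler_sum => r _.
  exact: lerD.
- rewrite ler_wpM2l ?invr_ge0 ?mulr_ge0 ?(ltW L1) ?(ltW L0)//.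
  apply: ler_sum => i _; apply: ler_sum => j _; apply: ler_sum => r _.
  exact: ler_sum.
Qed.

Lemma sum_notin_diag phi : (forall i, phi i i = 0) ->
  \sum_(i | i \notin S) \sum_(j | j \notin i |: S) phi i j
  = \sum_(i | i \notin S) \sum_(j | j \notin S) phi i j.
Proof.
move=> d0; apply: eq_bigr => i iS; rewrite [RHS](bigD1 i)//= d0 add0r.
by apply: eq_bigl => j; rewrite !inE negb_or andbC.
Qed.

Lemma sum_in_diag phi : (forall i, phi i i = 0) ->
  \sum_(i in S) \sum_(j in S :\ i) phi i j
  = \sum_(i in S) \sum_(j in S) phi i j.
Proof.
move=> d0; apply: eq_bigr => i iS; rewrite [RHS](bigD1 i)//= d0 add0r.
by apply: eq_bigl => j; rewrite !inE andbC.
Qed.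

Lemma sum_const_notinU1 j (c : R) : j \notin S ->
  \sum_(r | r \notin j |: S) c = (N - m - 1) * c.
Proof. by move=> jS; rewrite sum_const_notin cardsU1 jS add1n -natr1; ring. Qed.

(** Every pair is refilled with total weight one. *)
Lemma refill_shiftfree phi : (forall i, phi i i = 0) ->
  fill S (fun i j _ => phi i j) = \sum_i \sum_j phi i j.
Proof.
move=> d0; rewrite /refill sum_notin_diag//.
have -> : \sum_(i in S) \sum_(j | j \notin S)
      \sum_(r | r \notin j |: S) (phi i j + phi j i)
   = (N - m - 1) * (\sum_(i in S) \sum_(j | j \notin S) phi i j
       + \sum_(i | i \notin S) \sum_(j in S) phi i j).
  rewrite [X in _ = _ * (_ + X)]exchange_big/= -big_split/= mulr_sumr.
  apply: eq_bigr => i _.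
  rewrite -big_split/= mulr_sumr; apply: eq_bigr => j jS.
  by rewrite sum_const_notinU1.
have -> : \sum_(i in S) \sum_(j in S :\ i) \sum_(r | r \notin S)
       \sum_(r' | r' \notin r |: S) phi i j
   = ((N - m) * (N - m - 1)) * \sum_(i in S) \sum_(j in S) phi i j.
  rewrite -sum_in_diag// mulr_sumr; apply: eq_bigr => i _.
  rewrite mulr_sumr; apply: eq_bigr => j _.
  under eq_bigr => r rS do rewrite sum_const_notinU1//.
  by rewrite sum_const_notin mulrA.
rewrite !mulKf ?mulf_neq0 ?gt_eqF//.
rewrite [RHS](bigID (mem S))/=.
under [X in _ = X + _]eq_bigr do rewrite (bigID (mem S))/=.
under [X in _ = _ + X]eq_bigr do rewrite (bigID (mem S))/=.
rewrite !big_split/=; ring.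
Qed.

End room.

Lemma monomial_pair_sum (P Q : pred I) k l :
  \sum_(i | P i) \sum_(j | Q j) (a i ^+ k * a j ^+ l)
  = (\sum_(i | P i) a i ^+ k) * (\sum_(j | Q j) a j ^+ l).
Proof. by rewrite big_distrlr. Qed.

Local Notation s P k := (\sum_(i | P i) a i ^+ k).

Lemma weighted_pair_sum (P Q : pred I) (c0 c1 c2 : R) :
  \sum_(i | P i) \sum_(j | Q j) ((a i - a j) ^+ 2 * (c0 + c1 * a i + c2 * a j))
  = c0 * (s P 2 * s Q 0 - 2 * (s P 1 * s Q 1) + s P 0 * s Q 2)
  + c1 * (s P 3 * s Q 0 - 2 * (s P 2 * s Q 1) + s P 1 * s Q 2)
  + c2 * (s P 2 * s Q 1 - 2 * (s P 1 * s Q 2) + s P 0 * s Q 3).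
Proof.
rewrite -!monomial_pair_sum.
rewrite !(mulr_sumr, =^~ sumrN, =^~ big_split)/=; apply: eq_bigr => i _.
rewrite !(mulr_sumr, =^~ sumrN, =^~ big_split)/=; apply: eq_bigr => j _.
ring.
Qed.

Hypotheses (a1 : \sum_i a i ^+ 1 = 0) (a2 : \sum_i a i ^+ 2 = 1)
  (a3 : \sum_i a i ^+ 3 = 0).

Let s_notin S k :
  \sum_(i | i \notin S) a i ^+ k = \sum_i a i ^+ k - \sum_(i in S) a i ^+ k.
Proof. exact: sum_notin. Qed.

(** The fresh elements average over the complement of S, whose total is -Y 1; so
    the mean shift reduces to weighted pair sums over S and its complement, which
    are polynomials in the power sums of S. *)
Lemma refill_mean_shift S : (#|S|.+1 < #|I|)%N ->
  let Y k := \sum_(i in S) a i ^+ k in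
  fill S (fun i j d => (a i - a j) ^+ 2 * d)
  = 2 * N * (alpha R #|I| #|S|.+1 * Y 3 + beta R #|I| #|S|.+1 * (Y 1 * Y 2)
       + gamma R #|I| #|S|.+1 * Y 1 ^+ 3 + eta R #|I| #|S|.+1 * Y 1).
Proof.
move=> room Y.
pose m : R := #|S|%:R.
have L1 : 0 < N - m - 1 by rewrite -addrA -opprD natr1 subr_gt0 ltr_nat.
have L0 : 0 < N - m by lra.
have m0 : 0 <= m by exact: ler0n.
rewrite /refill -/m.
rewrite [X in X + _ + _]big1; last first.
  by move=> i _; rewrite big1// => j _; rewrite mulr0.
rewrite add0r.
have s1 j : j \notin S -> \sum_(r | r \notin j |: S) a r = - Y 1 - a j.
  move=> jS; rewrite sum_notin sum_U1//.
  by have := a1; rewrite /Y; under eq_bigr do rewrite expr1; move=> ->;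
     under [in RHS]eq_bigr do rewrite expr1; ring.
have -> : \sum_(i in S) \sum_(j | j \notin S) \sum_(r | r \notin j |: S)
    ((a i - a j) ^+ 2 * (a r - a i) + (a j - a i) ^+ 2 * (a r - a i))
  = \sum_(i in S) \sum_(j | j \notin S) ((a i - a j) ^+ 2 *
       (- 2 * Y 1 + (- 2 * (N - m - 1)) * a i + (- 2) * a j)).
  apply: eq_bigr => i iS; apply: eq_bigr => j jS.
  rewrite big_split/= -!mulr_sumr sumrB s1// sum_const_notinU1//.
  rewrite -/m; ring.
have -> : \sum_(i in S) \sum_(j in S :\ i) \sum_(r | r \notin S)
       \sum_(r' | r' \notin r |: S) (a i - a j) ^+ 2 * (a r + a r' - a i - a j)
  = \sum_(i in S) \sum_(j in S) ((a i - a j) ^+ 2 *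
     (- 2 * (N - m - 1) * Y 1 + (- ((N - m) * (N - m - 1))) * a i
      + (- ((N - m) * (N - m - 1))) * a j)).
  rewrite -sum_in_diag; last by move=> i; rewrite subrr expr0n mul0r.
  apply: eq_bigr => i iS; apply: eq_bigr => j jS.
  under eq_bigr => r rS.
    rewrite -mulr_sumr !sumrB big_split/= s1// !sum_const_notinU1//.
    over.
  rewrite -mulr_sumr !big_split/= !sumrN -!mulr_sumr !sum_const_notin -/m.
  rewrite (_ : \sum_(r | r \notin S) a r = - Y 1); last first.
    rewrite sum_notin; have := a1; rewrite /Y.
    under eq_bigr do rewrite expr1; move=> ->.
    by under [in RHS]eq_bigr do rewrite expr1; ring.
  ring.
rewrite !(weighted_pair_sum (mem S)) !s_notin a1 a2 a3.
have -> : \sum_(i | mem S i) a i ^+ 0 = m.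
  by rewrite (eq_bigr (fun=> 1))// sumr_const.
have -> : \sum_i a i ^+ 0 = N.
  by rewrite (eq_bigr (fun=> 1))// sumr_const.
rewrite -/(Y 1) -/(Y 2) -/(Y 3).
have mS : #|S|.+1%:R = m + 1 by rewrite natr1.
rewrite /alpha /beta /gamma /eta mS.
have -> : N - (m + 1) = N - m - 1 by ring.
have -> : N - m - 1 + 1 = N - m by ring.
field.
rewrite !gt_eqF//; lra.
Qed.

End refill_moments.

(** * Second moments *)

Section refill_quadratic.
Context {R : realType} {I : finType}.
Implicit Types (S T U : {set I}) (i j r : I) (b : I -> R) (m : nat).
Local Notation N := (#|I|%:R : R).

Lemma sum_pair_sqr b : \sum_i b i = 0 ->
  \sum_i \sum_j (b i - b j) ^+ 2 = 2 * N * \sum_i b i ^+ 2.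
Proof.
move=> b0.
have E i : \sum_j (b i - b j) ^+ 2 = N * b i ^+ 2 + \sum_j b j ^+ 2.
  rewrite (eq_bigr (fun j => b i ^+ 2 + (b j ^+ 2 + (- 2 * b i) * b j))).
    by rewrite !big_split/= sumr_const -mulr_sumr b0 mulr0 addr0 mulr_natl.
  by move=> j _; ring.
under eq_bigr do rewrite E.
by rewrite big_split/= -mulr_sumr sumr_const -[X in _ + X = _]mulr_natl; ring.
Qed.

Lemma sum_subset_cst m (c : R) :
  \sum_(S : {set I} | #|S| == m) c = 'C(#|I|, m)%:R * c.
Proof.
rewrite sumr_const mulr_natl; congr (_ *+ _).
by rewrite -card_draws; apply: eq_card => S; rewrite !inE.
Qed.

(** For the identity function, the pair side of sum_subset_stein is the refill of
    a weight that ignores the shift, hence a pair sum over the whole population. *)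
Lemma sum_subset_second_moment m b : (m.+1 < #|I|)%N -> \sum_i b i = 0 ->
  \sum_(S : {set I} | #|S| == m.+1) (\sum_(i in S) b i) ^+ 2
  = (N - m%:R) * (N - m.+1%:R) / (N * (N - 1)) * 'C(#|I|, m)%:R * \sum_i b i ^+ 2.
Proof.
move=> mI b0.
have mI' : (m.+1%:R : R) < N by rewrite ltr_nat.
have m0 : 0 <= m%:R :> R by exact: ler0n.
have mS : m.+1%:R = m%:R + 1 :> R by rewrite natr1.
have := @sum_subset_stein R I m b id b0.
under [in RHS]eq_bigr do rewrite -expr2.
have := @refill_coupling R I b m (fun i j _ => (b i - b j) ^+ 2) mI.
rewrite (eq_bigr (fun=> 2 * N * \sum_i b i ^+ 2)); last first.
  move=> S /eqP Sm; rewrite refill_shiftfree ?Sm// ?sum_pair_sqr// => i.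
  by rewrite subrr expr0n.
rewrite sum_subset_cst => E1 E2.
pose W := \sum_(S : {set I} | #|S| == m.+1) (\sum_(k in S) b k) ^+ 2.
rewrite -/W in E2 *.
have E3 : 2 * N * W = \sum_(T : {set I} | #|T| == m) \sum_(i | i \notin T)
    \sum_(j | j \notin i |: T) (b i - b j) ^+ 2.
  rewrite -E2; apply: eq_bigr => T _.
  rewrite sum_notin_diag; last by move=> i; rewrite subrr expr0n.
  by apply: eq_bigr => i _; apply: eq_bigr => j _ /=; ring.
rewrite -E3 in E1.
have N0 : N != 0 by rewrite gt_eqF//; lra.
have : 2 * N * W * (N * (N - 1)) = 2 * N *
    ('C(#|I|, m)%:R * (\sum_i b i ^+ 2) * ((N - m%:R) * (N - m.+1%:R))).
  rewrite mS; rewrite mS in mI'.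
  have -> : 2 * N * W = ((N - m%:R) * (N - m%:R - 1) / (N * (N - 1))) *
      ('C(#|I|, m)%:R * (2 * N * \sum_i b i ^+ 2)).
    by rewrite E1; field; rewrite N0 !gt_eqF//; lra.
  by field; rewrite N0 !gt_eqF//; lra.
have N20 : 2 * N != 0 by rewrite mulf_neq0 ?N0 ?pnatr_eq0.
rewrite -[2 * N * W * _]mulrA => /(mulfI N20) H.
apply: (@mulIf _ (N * (N - 1))); first by rewrite mulf_neq0// gt_eqF//; lra.
by rewrite H; field; rewrite N0 gt_eqF//; lra.
Qed.

Lemma sum_subset_second_moment_le m b : (m < #|I|)%N -> \sum_i b i = 0 ->
  \sum_(S : {set I} | #|S| == m) (\sum_(i in S) b i) ^+ 2
  <= 'C(#|I|, m)%:R * \sum_i b i ^+ 2.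
Proof.
have sq0 : 0 <= \sum_i b i ^+ 2 by apply: sumr_ge0 => i _; exact: sqr_ge0.
case: m => [|m] mI b0.
  rewrite big1; first by rewrite mulr_ge0 ?ler0n.
  by move=> S /eqP/cards0_eq ->; rewrite big_set0 expr0n.
rewrite sum_subset_second_moment// ler_wpM2r//.
have := mul_bin_left #|I| m => /(congr1 (fun k => k%:R : R)).
rewrite !natrM natrB; last by rewrite ltnW// ltnW.
have mI' : (m.+1%:R : R) < N by rewrite ltr_nat.
have m0 : 0 <= m%:R :> R by exact: ler0n.
have mS : m.+1%:R = m%:R + 1 :> R by rewrite natr1.
move=> E.
rewrite mulrAC ler_pdivrMr; last by rewrite mulr_gt0//; lra.
rewrite mulrAC -E mS; rewrite mS in mI'.
have C0 : 0 <= 'C(#|I|, m.+1)%:R :> R by exact: ler0n.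
rewrite -mulrA mulrCA; apply: ler_wpM2l => //.
set x := N in mI' *; nra.
Qed.

Section bound.
Variable a : I -> R.
Hypotheses (a1 : \sum_i a i ^+ 1 = 0) (a2 : \sum_i a i ^+ 2 = 1)
  (a3 : \sum_i a i ^+ 3 = 0).
Local Notation fill := (refill a).
Local Notation p4 := (\sum_i a i ^+ 4).

Let sum_a : \sum_i a i = 0.
Proof. by rewrite -[RHS]a1; apply: eq_bigr => i _; rewrite expr1. Qed.

Lemma refill_weight S : (#|S|.+1 < #|I|)%N ->
  fill S (fun i j _ => (a i - a j) ^+ 2) = 2 * N.
Proof.
move=> room; rewrite refill_shiftfree//; last by move=> i; rewrite subrr expr0n.
by rewrite sum_pair_sqr// a2 mulr1.
Qed.

Lemma refill_centre S : (#|S|.+1 < #|I|)%N ->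
  fill S (fun i j _ => (a i - a j) ^+ 2 * ((a i + a j) / 2)) = 0.
Proof.
move=> room; rewrite refill_shiftfree//; last by move=> i; rewrite subrr expr0n mul0r.
have E := weighted_pair_sum a predT predT 0 2^-1 2^-1.
rewrite a1 a2 a3 in E.
transitivity (\sum_i \sum_j (a i - a j) ^+ 2 * (0 + 2^-1 * a i + 2^-1 * a j)).
  by apply: eq_bigr => i _; apply: eq_bigr => j _; congr (_ * _); field.
by rewrite E; ring.
Qed.

(** The weight times the quadratic form is
    (a_i - a_j) ((a_i - t)^3 - (a_j - t)^3), whose pair sum involves power sums
    of the whole population only. *)
Lemma refill_static S (t : R) : (#|S|.+1 < #|I|)%N ->
  fill S (fun i j _ => (a i - a j) ^+ 2 *
     ((a i - t) ^+ 2 + (a i - t) * (a j - t) + (a j - t) ^+ 2))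
  = 2 * N * (p4 + 3 * t ^+ 2).
Proof.
move=> room; rewrite refill_shiftfree; last 2 first.
- by [].
- by move=> i; rewrite subrr expr0n mul0r.
have a0 : \sum_i a i ^+ 0 = N by rewrite (eq_bigr (fun=> 1))// sumr_const.
pose M k l := \sum_i \sum_j a i ^+ k * a j ^+ l.
have ME k l : M k l = (\sum_i a i ^+ k) * (\sum_i a i ^+ l).
  exact: monomial_pair_sum.
transitivity ((M 4 0 + M 0 4 - M 3 1 - M 1 3)
     + (- 3 * t) * (M 3 0 + M 0 3 - M 2 1 - M 1 2)
     + 3 * t ^+ 2 * \sum_i \sum_j (a i - a j) ^+ 2); last first.
  by rewrite sum_pair_sqr// !ME a0 a1 a2 a3; ring.
rewrite /M.
rewrite !(mulr_sumr, =^~ sumrN, =^~ big_split)/=; apply: eq_bigr => i _.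
rewrite !(mulr_sumr, =^~ sumrN, =^~ big_split)/=; apply: eq_bigr => j _.
ring.
Qed.

(** With one expelled element, d^2 <= 2 a_r^2 + 2 a_i^2; with two, d^2 is at most
    four times the sum of the four squares.  The expelled squares contribute the
    fourth power sum.  The fresh ones average at most z / (N - m - 1), where z is
    the sum of a_r^2 over the complement of S, and z (1 - z) <= 1/4.  As the mean
    of z over S is (N - m) / N, the last term averages to at most 16. *)
Lemma refill_sqr_shift_le S : (#|S|.+1 < #|I|)%N ->
  fill S (fun i j d => (a i - a j) ^+ 2 * d ^+ 2)
  <= 8 * (N * p4 + 1) + 4
     + 16 * #|S|%:R * (1 - \sum_(i in S) a i ^+ 2) / (N - #|S|%:R).
Proof.
move=> room; pose z := 1 - \sum_(i in S) a i ^+ 2.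
pose m : R := #|S|%:R.
have mI' : m + 1 + 1 <= N by rewrite /m !natr1 ler_nat.
pose L0 := N - m; pose L1 := N - m - 1.
have L1p : 0 < L1 by rewrite /L1; lra.
have L0p : 0 < L0 by rewrite /L0; lra.
have m0 : 0 <= m by exact: ler0n.
pose Y2 := \sum_(i in S) a i ^+ 2.
have zC : z = \sum_(r | r \notin S) a r ^+ 2.
  by rewrite (sum_notin S (fun i => a i ^+ 2)) a2.
have z0 : 0 <= z by rewrite zC; apply: sumr_ge0 => i _; exact: sqr_ge0.
have Y20 : 0 <= Y2 by apply: sumr_ge0 => i _; exact: sqr_ge0.
have Yz : Y2 = 1 - z by rewrite /z /Y2; ring.
pose w i j := (a i - a j) ^+ 2.
have w0 i j : 0 <= w i j by exact: sqr_ge0.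
pose WA := \sum_(i in S) \sum_(j | j \notin S) w i j.
pose WB := \sum_(i in S) \sum_(j in S) w i j.
pose V := \sum_(i in S) \sum_j w i j * a i ^+ 2.
pose VA := \sum_(i in S) \sum_(j | j \notin S) w i j * a i ^+ 2.
pose VB := \sum_(i in S) \sum_(j in S) w i j * a i ^+ 2.
have VE : VA + VB = V.
  rewrite /VA /VB /V -big_split/=; apply: eq_bigr => i _.
  by rewrite addrC [RHS](bigID (mem S)).
have V_le : V <= N * p4 + 1.
  have E : V = \sum_(i in S) (N * a i ^+ 4 + a i ^+ 2).
    apply: eq_bigr => i _; rewrite -mulr_suml.
    rewrite (eq_bigr (fun j => a i ^+ 2 + (a j ^+ 2 + (- 2 * a i) * a j))).
      rewrite !big_split/= sumr_const -mulr_sumr sum_a a2 -[X in X + _]mulr_natl; ring.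
    by move=> j _; rewrite /w; ring.
  rewrite E big_split/= -mulr_sumr; apply: lerD; last by rewrite -/Y2; lra.
  rewrite ler_wpM2l ?ler0n// [leRHS](bigID (mem S))/= lerDl.
  by apply: sumr_ge0 => i _; exact: exprn_even_ge0.
have s0 : \sum_(i in S) a i ^+ 0 = m by rewrite (eq_bigr (fun=> 1))// sumr_const.
pose Y1 := \sum_(i in S) a i ^+ 1.
have s0C : \sum_(i | i \notin S) a i ^+ 0 = L0.
  by rewrite (eq_bigr (fun=> 1))// sum_const_notin mulr1.
have s1C : \sum_(i | i \notin S) a i ^+ 1 = - Y1.
  by rewrite (sum_notin S (fun i => a i ^+ 1)) a1 sub0r.
have WAE : WA = Y2 * L0 + 2 * Y1 ^+ 2 + m * z.
  have := weighted_pair_sum a (mem S) (fun j => j \notin S) 1 0 0.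
  rewrite s0 s0C s1C -zC -/Y1 -/Y2.
  under eq_bigr do under eq_bigr do rewrite !mul0r !addr0 mulr1.
  by rewrite -/WA => ->; ring.
have WBE : WB = 2 * (m * Y2) - 2 * Y1 ^+ 2.
  have := weighted_pair_sum a (mem S) (mem S) 1 0 0.
  rewrite s0 -/Y1 -/Y2.
  under eq_bigr do under eq_bigr do rewrite !mul0r !addr0 mulr1.
  by rewrite -/WB => ->; ring.
have Y1_le : 2 * Y1 ^+ 2 <= Y2 * L0 + m * z.
  have : 0 <= \sum_(i in S) \sum_(j | j \notin S) (a i + a j) ^+ 2.
    by apply: sumr_ge0 => i _; apply: sumr_ge0 => j _; exact: sqr_ge0.
  have -> : \sum_(i in S) \sum_(j | j \notin S) (a i + a j) ^+ 2
     = Y2 * L0 + m * z + 2 * (Y1 * - Y1).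
    rewrite -s0 -s0C -s1C zC -!(monomial_pair_sum a (mem S)).
    rewrite !(mulr_sumr, =^~ sumrN, =^~ big_split)/=; apply: eq_bigr => i _.
    rewrite !(mulr_sumr, =^~ sumrN, =^~ big_split)/=; apply: eq_bigr => j _.
    ring.
  lra.
have step : fill S (fun i j d => (a i - a j) ^+ 2 * d ^+ 2)
  <= L1^-1 * (4 * z * WA + 4 * L1 * VA)
     + (L0 * L1)^-1 * (8 * L1 * z * WB + 8 * L0 * L1 * VB).
  rewrite /refill -/m -/L0 -/L1.
  rewrite [X in X + _ + _]big1 ?add0r; last first.
    by move=> i _; rewrite big1// => j _; rewrite expr0n mulr0.
  apply: lerD.
    rewrite ler_wpM2l ?invr_ge0 ?(ltW L1p)//.
    rewrite !mulr_sumr -big_split/=; apply: ler_sum => i iS.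
    rewrite !mulr_sumr -big_split/=; apply: ler_sum => j jS.
    have -> : \sum_(r | r \notin j |: S) ((a i - a j) ^+ 2 * (a r - a i) ^+ 2 +
         (a j - a i) ^+ 2 * (a r - a i) ^+ 2)
       = 2 * w i j * \sum_(r | r \notin j |: S) (a r - a i) ^+ 2.
      by rewrite mulr_sumr; apply: eq_bigr => r _; rewrite /w; ring.
    have : \sum_(r | r \notin j |: S) (a r - a i) ^+ 2 <= 2 * z + 2 * L1 * a i ^+ 2.
      apply: (@le_trans _ _ (\sum_(r | r \notin j |: S) (2 * a r ^+ 2 + 2 * a i ^+ 2))).
        apply: ler_sum => r _; have := sqr_ge0 (a r + a i); nra.
      rewrite big_split/= sum_const_notinU1// -/m -/L1 -mulr_sumr.
      rewrite (sum_notin (j |: S) (fun r => a r ^+ 2)) a2.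
      rewrite (@sum_U1 _ _ _ _ (fun r => a r ^+ 2))//.
      rewrite -/Y2; have := sqr_ge0 (a j); lra.
    move=> /(ler_wpM2l (mulr_ge0 (ler0n _ 2) (w0 i j))); lra.
  rewrite ler_wpM2l ?invr_ge0 ?mulr_ge0 ?(ltW L1p) ?(ltW L0p)//.
  have VBs : 2 * VB = \sum_(i in S) \sum_(j in S) w i j * (a i ^+ 2 + a j ^+ 2).
    rewrite mulr2n mulrDl mul1r {2}/VB exchange_big/= /VB -big_split/=.
    apply: eq_bigr => i _; rewrite -big_split/=; apply: eq_bigr => j _.
    by rewrite /w; ring.
  have -> : 8 * L1 * z * WB + 8 * L0 * L1 * VB
    = 8 * L1 * z * WB + 4 * L0 * L1 * (2 * VB) by ring.
  have -> : 8 * L1 * z * WB + 4 * L0 * L1 * (2 * VB)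
    = \sum_(i in S) \sum_(j in S)
        w i j * (8 * L1 * z + 4 * L0 * L1 * (a i ^+ 2 + a j ^+ 2)).
    rewrite VBs /WB !mulr_sumr -big_split/=; apply: eq_bigr => i _.
    rewrite !mulr_sumr -big_split/=; apply: eq_bigr => j _; ring.
  rewrite -[leRHS]sum_in_diag; last by move=> i; rewrite /w subrr expr0n mul0r.
  apply: ler_sum => i _; apply: ler_sum => j _.
  under eq_bigr do rewrite -mulr_sumr.
  rewrite -mulr_sumr; apply: ler_wpM2l; first exact: w0.
  apply: (@le_trans _ _ (\sum_(r | r \notin S) \sum_(r' | r' \notin r |: S)
     (4 * a r' ^+ 2 + 4 * (a r ^+ 2 + a i ^+ 2 + a j ^+ 2)))).
    apply: ler_sum => r _; apply: ler_sum => r' _.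
    have := sqr_ge0 (a r - a r'); have := sqr_ge0 (a i - a j).
    have := sqr_ge0 (a r + a i); have := sqr_ge0 (a r + a j).
    have := sqr_ge0 (a r' + a i); have := sqr_ge0 (a r' + a j).
    lra.
  rewrite (eq_bigr (fun r => 4 * (z - a r ^+ 2) +
      L1 * (4 * (a r ^+ 2 + a i ^+ 2 + a j ^+ 2)))); last first.
    move=> r rS; rewrite big_split/= -mulr_sumr sum_const_notinU1// -/m -/L1.
    rewrite (sum_notin (r |: S) (fun k => a k ^+ 2)) a2.
    rewrite (@sum_U1 _ _ _ _ (fun k => a k ^+ 2))//.
    by congr (4 * _ + _); rewrite -/Y2 Yz; ring.
  rewrite big_split/= -!mulr_sumr.
  have -> : \sum_(r | r \notin S) (z - a r ^+ 2) = L0 * z - z.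
    by rewrite big_split/= sum_const_notin sumrN -zC.
  have -> : \sum_(r | r \notin S) (a r ^+ 2 + a i ^+ 2 + a j ^+ 2)
      = z + L0 * a i ^+ 2 + L0 * a j ^+ 2.
    by rewrite big_split/= sum_const_notin big_split/= sum_const_notin -zC.
  by rewrite le_eqVlt; apply/orP; left; apply/eqP; rewrite /L0 /L1; ring.
apply: le_trans step _.
have VA0 : 0 <= VA.
  apply: sumr_ge0 => i _; apply: sumr_ge0 => j _.
  by rewrite mulr_ge0 ?sqr_ge0.
have WA0 : 0 <= Y2 * L0 + m * z by rewrite addr_ge0// mulr_ge0// ltW.
(* L0 = L1 + 1 >= 2, because m + 1 < N *)
have iL : L1^-1 <= 2 * L0^-1.
  rewrite -div1r ler_pdivrMr// mulrAC ler_pdivlMr// mul1r.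
  by rewrite /L0 /L1; lra.
have -> : L1^-1 * (4 * z * WA + 4 * L1 * VA)
     + (L0 * L1)^-1 * (8 * L1 * z * WB + 8 * L0 * L1 * VB)
  = L1^-1 * (4 * z * WA) + 8 * z * WB / L0 + 8 * V - 4 * VA.
  by rewrite -VE; field; rewrite !gt_eqF.
have t1 : L1^-1 * (4 * z * WA) <= 2 * L0^-1 * (8 * z * (Y2 * L0 + m * z)).
  apply: ler_pM => //.
  - by rewrite invr_ge0 ltW.
  - by rewrite !mulr_ge0// WAE; have := sqr_ge0 Y1; lra.
  - have : 0 <= 4 * z by rewrite mulr_ge0.
    by move=> /ler_wpM2l H; have := H _ _ Y1_le; rewrite WAE; lra.
have t2 : 8 * z * WB / L0 <= 16 * m * z * Y2 / L0.
  apply: ler_wpM2r; first by rewrite invr_ge0 ltW.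
  rewrite WBE; have : 0 <= z * Y1 ^+ 2 by rewrite mulr_ge0 ?sqr_ge0.
  lra.
have t3 : 2 * L0^-1 * (8 * z * (Y2 * L0 + m * z)) + 16 * m * z * Y2 / L0
   = 16 * m * z / L0 + 16 * (z * (1 - z)).
  by rewrite Yz; field; rewrite gt_eqF.
have := sqr_ge0 (2 * z - 1).
rewrite -/z -/m -/L0; lra.
Qed.
End bound.
End refill_quadratic.

(** * Stein's bound for sums over subsets *)

Section sampling_bound.
Context {R : realType} {I : finType}.
Variables (a : I -> R) (m : nat).
Implicit Types (S T U : {set I}) (i j r p : I).
Local Notation N := (#|I|%:R : R).
Local Notation n := (m.+1%:R : R).
Local Notation fill := (refill a).
Local Notation p4 := (\sum_i a i ^+ 4).
Local Notation p6 := (\sum_i a i ^+ 6).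
Hypotheses (a1 : \sum_i a i ^+ 1 = 0) (a2 : \sum_i a i ^+ 2 = 1)
  (a3 : \sum_i a i ^+ 3 = 0) (mI : (m.+1 < #|I|)%N).

Local Notation al := (alpha R #|I| m.+1).
Local Notation be := (beta R #|I| m.+1).
Local Notation ga := (gamma R #|I| m.+1).
Local Notation et := (eta R #|I| m.+1).
Local Notation Cn := ('C(#|I|, m.+1)%:R : R).
Local Notation Cm := ('C(#|I|, m)%:R : R).

(** The square of sigma, for samples of size m.+1. *)
Definition sampling_variance : R := n * (N - n) / (N * (N - 1)).
Local Notation s2 := sampling_variance.

(** Conditional mean of V - W + a_p, given the sample S before p is added. *)
Definition mean_shift S : R :=
  let Y k := \sum_(i in S) a i ^+ k in
  al * Y 3 + be * (Y 1%N * Y 2) + ga * Y 1%N ^+ 3 + et * Y 1%N.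

(** The square of the constant C1. *)
Definition mean_shift_scale : R :=
  8 * (s2 / (4 * n ^+ 2) + p6 * al ^+ 2 + be ^+ 2 + ga ^+ 2 * m%:R ^+ 2 + et ^+ 2).

Let nN : n + 1 <= N. Proof. by rewrite natr1 ler_nat. Qed.
Let mn : n = m%:R + 1. Proof. by rewrite natr1. Qed.
Let m0 : 0 <= m%:R :> R. Proof. exact: ler0n. Qed.
Let sum_a : \sum_i a i = 0.
Proof. by rewrite -[RHS]a1; apply: eq_bigr => i _; rewrite expr1. Qed.

Let s20 : 0 < s2.
Proof.
by rewrite divr_gt0 ?mulr_gt0//; have := nN; have := mn; have := m0; lra.
Qed.

Let CnE : n * Cn = (N - m%:R) * Cm.
Proof.
have := mul_bin_left #|I| m => /(congr1 (fun k => k%:R : R)).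
by rewrite !natrM natrB// ltnW// ltnW.
Qed.

Lemma sum_after_last (F : {set I} -> I -> R) (K : {set I} -> R) :
  (forall S p, p \notin S -> F S p = K (p |: S)) ->
  \sum_(S : {set I} | #|S| == m) \sum_(p | p \notin S) F S p
  = n * \sum_(S : {set I} | #|S| == m.+1) K S.
Proof.
move=> FK; rewrite -sum_insert; apply: eq_bigr => S _; apply: eq_bigr => p.
exact: FK.
Qed.

Lemma sum_before_last (K : {set I} -> R) :
  \sum_(S : {set I} | #|S| == m) \sum_(p | p \notin S) K S
  = (N - m%:R) * \sum_(S : {set I} | #|S| == m) K S.
Proof.
rewrite mulr_sumr; apply: eq_bigr => S /eqP Sm.
by rewrite sum_const_notin Sm.
Qed.

Lemma sum_second_moment :
  \sum_(S : {set I} | #|S| == m.+1) (\sum_(i in S) a i) ^+ 2 = Cn * s2.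
Proof.
rewrite sum_subset_second_moment// a2 /s2 mulr1.
have -> : Cn = (N - m%:R) * Cm / n by rewrite -CnE mulrC mulKf// pnatr_eq0.
have := nN; have := mn; have := m0 => *.
field; by rewrite !gt_eqF//; lra.
Qed.

Lemma sum_outside_sqr :
  \sum_(S : {set I} | #|S| == m) (1 - \sum_(i in S) a i ^+ 2) = n * Cn / N.
Proof.
rewrite sumrB sum_subset_cst mulr1.
have mI' : (m <= #|I|)%N by rewrite ltnW// ltnW.
have := sum_subset_first_moment (fun i => a i ^+ 2) mI'; rewrite a2 mulr1 => E.
have N0 : N != 0 by rewrite gt_eqF//; have := nN; have := m0; have := mn; lra.
by apply: (mulfI N0); rewrite mulrBr E CnE; field.
Qed.

(** Of the four terms, the first has mean square at most p6 al^2.  In the others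
    Y 2 <= 1 and Y 1 ^+ 2 <= m leave a multiple of Y 1 ^+ 2, of mean at most 1. *)
Lemma sum_mean_shift_sqr :
  \sum_(S : {set I} | #|S| == m) mean_shift S ^+ 2
  <= 4 * (p6 * al ^+ 2 + be ^+ 2 + ga ^+ 2 * m%:R ^+ 2 + et ^+ 2) * Cm.
Proof.
have mI' : (m < #|I|)%N by rewrite ltnW.
have V1 := sum_subset_second_moment_le mI' a1.
have V3 := sum_subset_second_moment_le mI' a3.
pose Y k S := \sum_(i in S) a i ^+ k.
have bnd S : #|S| == m -> mean_shift S ^+ 2 <=
    4 * al ^+ 2 * Y 3 S ^+ 2
    + 4 * (be ^+ 2 + ga ^+ 2 * m%:R ^+ 2 + et ^+ 2) * Y 1 S ^+ 2.
  move=> /eqP Sm; rewrite /mean_shift -/(Y 1 S) -/(Y 2 S) -/(Y 3 S).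
  have Y2_ge0 : 0 <= Y 2 S by apply: sumr_ge0 => i _; exact: sqr_ge0.
  have Y2_le1 : Y 2 S <= 1.
    rewrite -a2 [leRHS](bigID (mem S))/= lerDl.
    by apply: sumr_ge0 => i _; exact: sqr_ge0.
  have Y1_le : Y 1 S ^+ 2 <= m%:R.
    have H : 0 <= \sum_(i in S) \sum_(j in S) (a i - a j) ^+ 2.
      by apply: sumr_ge0 => i _; apply: sumr_ge0 => j _; exact: sqr_ge0.
    have s0 : \sum_(i in S) a i ^+ 0 = m%:R.
      by rewrite (eq_bigr (fun=> 1))// sumr_const Sm.
    have := weighted_pair_sum a (mem S) (mem S) 1 0 0.
    rewrite s0 -/(Y 1 S) -/(Y 2 S).
    under eq_bigr do under eq_bigr do rewrite !mul0r !addr0 mulr1.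
    move=> E; rewrite E in H.
    have := ler_wpM2l m0 Y2_le1; lra.
  have Y1_ge0 : 0 <= Y 1 S ^+ 2 by exact: sqr_ge0.
  set y3 := Y 3 S; set y1 := Y 1 S in Y1_le Y1_ge0 *.
  set y2 := Y 2 S in Y2_ge0 Y2_le1 *.
  have four (x y z t : R) :
      (x + y + z + t) ^+ 2 <= 4 * (x ^+ 2 + y ^+ 2 + z ^+ 2 + t ^+ 2).
    have := sqr_ge0 (x - y); have := sqr_ge0 (x - z); have := sqr_ge0 (x - t).
    have := sqr_ge0 (y - z); have := sqr_ge0 (y - t); have := sqr_ge0 (z - t); lra.
  apply: le_trans (four _ _ _ _) _.
  have q1 : (be * (y1 * y2)) ^+ 2 <= be ^+ 2 * y1 ^+ 2.
    rewrite !exprMn mulrA; apply: ler_piMr; first by rewrite mulr_ge0 ?sqr_ge0.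
    by rewrite expr_le1.
  have q2 : (ga * y1 ^+ 3) ^+ 2 <= ga ^+ 2 * m%:R ^+ 2 * y1 ^+ 2.
    have -> : (ga * y1 ^+ 3) ^+ 2 = ga ^+ 2 * (y1 ^+ 2) ^+ 2 * y1 ^+ 2 by ring.
    apply: ler_wpM2r => //; apply: ler_wpM2l; first exact: sqr_ge0.
    by rewrite lerXn2r// nnegrE.
  have q0 : (al * y3) ^+ 2 = al ^+ 2 * y3 ^+ 2 by rewrite exprMn.
  have q3 : (et * y1) ^+ 2 = et ^+ 2 * y1 ^+ 2 by rewrite exprMn.
  rewrite q0 q3; lra.
apply: (le_trans (ler_sum _ bnd)).
rewrite big_split/= -!mulr_sumr.
have -> : p6 = \sum_i (a i ^+ 3) ^+ 2 by apply: eq_bigr => i _; rewrite -exprM.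
rewrite (_ : \sum_i (a i ^+ 1) ^+ 2 = 1) in V1; last first.
  by rewrite -a2; apply: eq_bigr => i _; rewrite expr1.
have c1 : 0 <= 4 * al ^+ 2 by rewrite mulr_ge0 ?sqr_ge0.
have c2 : 0 <= 4 * (be ^+ 2 + ga ^+ 2 * m%:R ^+ 2 + et ^+ 2).
  have := sqr_ge0 (ga * m%:R); rewrite exprMn.
  have := sqr_ge0 be; have := sqr_ge0 et; lra.
have := ler_wpM2l c1 V3; have := ler_wpM2l c2 V1; rewrite /Y; lra.
Qed.


Let L0 : 0 < N - m%:R. Proof. by have := nN; have := mn; lra. Qed.
Let L1 : 0 < N - m%:R - 1. Proof. by have := nN; have := mn; lra. Qed.
Let N0 : 0 < N. Proof. by have := nN; have := m0; have := mn; lra. Qed.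

(** W g(W) written as an average over the sample S before the last element p is
    added; the inner expression does not depend on p. *)
Lemma sum_refill_stein (g : R -> R) :
  let W S := \sum_(i in S) a i in
  s2 / (2 * N) * (\sum_(S : {set I} | #|S| == m) \sum_(p | p \notin S)
     fill S (fun i j d => (a i - a j) * (g (W S + d + a i) - g (W S + d + a j))))
  = n * \sum_(S : {set I} | #|S| == m.+1) W S * g (W S).
Proof.
move=> W.
rewrite (sum_before_last (fun S => fill S (fun i j d =>
  (a i - a j) * (g (W S + d + a i) - g (W S + d + a j))))).
have := refill_coupling a
  (fun i j y => (a i - a j) * (g (y + a i) - g (y + a j))) mI.
rewrite /= => ->.
set X := \sum_(T | _) _.
have -> : X = 2 * N * \sum_(S : {set I} | #|S| == m.+1) W S * g (W S).
  rewrite -(sum_subset_stein m g sum_a); apply: eq_bigr => T _.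
  by rewrite sum_notin_diag// => i; rewrite subrr mul0r.
rewrite /sampling_variance mn.
have -> : N - (m%:R + 1) = N - m%:R - 1 by ring.
have := L0; have := L1; have := N0; have := nN; have := mn; have := m0 => *.
by field; rewrite !gt_eqF//; lra.
Qed.

Lemma refill_eq S (psi psi' : I -> I -> R -> R) :
  (forall i j d, psi i j d = psi' i j d) -> fill S psi = fill S psi'.
Proof.
by move=> E; congr (fill S _); apply/funext => i; apply/funext => j; apply/funext.
Qed.

Section test_function.
Variables (g g' g'' g''' : R -> R) (M2 M3 : R).
Hypotheses (dg : forall t : R, is_derive t 1 g (g' t))
  (dg' : forall t : R, is_derive t 1 g' (g'' t))
  (dg'' : forall t : R, is_derive t 1 g'' (g''' t))
  (g2M : forall t, `|g'' t| <= M2) (g3M : forall t, `|g''' t| <= M3).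
Local Notation W S := (\sum_(i in S) a i).

(** Expansion around the point w = a(S) + a p.  Refilling moves the two points
    between which g is compared to w + x and w + y, with
    x = a_i - a_p + d and y = a_j - a_p + d. *)
Lemma refill_expansion S p : #|S| = m ->
  `|fill S (fun i j d => (a i - a j) * (g (W S + d + a i) - g (W S + d + a j)))
     - 2 * N * (g' (W S + a p) + g'' (W S + a p) * (mean_shift S - a p))|
  <= M3 / 6 * (52 * N * p4 + 72 + 12 * N * a p ^+ 2
        + 96 * m%:R * (1 - \sum_(i in S) a i ^+ 2) / (N - m%:R)).
Proof.
move=> Sm; set w := W S + a p.
have room : (#|S|.+1 < #|I|)%N by rewrite Sm.
pose wt i j := (a i - a j) ^+ 2.
pose psi1 i j d := (a i - a j) * (g (W S + d + a i) - g (W S + d + a j)).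
pose psi2 i j d := wt i j * (g' w + g'' w * ((a i + a j) / 2 - a p + d)).
pose quad (x y : R) := x ^+ 2 + x * y + y ^+ 2.
pose psi3 i j d := wt i j * quad (a i - a p + d) (a j - a p + d).
have M30 : 0 <= M3 by apply: le_trans (g3M 0).
have E2 : fill S psi2 = 2 * N * (g' w + g'' w * (mean_shift S - a p)).
  rewrite (@refill_eq S psi2 (fun i j d => (wt i j + (g' w - g'' w * a p - 1) * wt i j)
     + g'' w * (wt i j * ((a i + a j) / 2) + 1 * (wt i j * d)))); last first.
    by move=> i j d; rewrite /psi2; ring.
  rewrite !refill_lin refill_weight// refill_centre// refill_mean_shift// Sm.
  by rewrite /mean_shift; ring.
have E3 : fill S psi3 <= 52 * N * p4 + 72 + 12 * N * a p ^+ 2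
        + 96 * m%:R * (1 - \sum_(i in S) a i ^+ 2) / (N - m%:R).
  apply: (@le_trans _ _ (fill S (fun i j d =>
     (wt i j * quad (a i - a p) (a j - a p) + 1 * (wt i j * quad (a i - a p) (a j - a p)))
     + 6 * (wt i j * d ^+ 2)))).
    apply: refill_le => // i j d; rewrite /psi3.
    have wt0 : 0 <= wt i j by exact: sqr_ge0.
    set x := a i - a p; set y := a j - a p.
    (* quad (x + d) (y + d) + quad (x - d) (y - d) = 2 quad x y + 6 d^2 *)
    have : 0 <= wt i j * quad (x - d) (y - d).
      rewrite mulr_ge0// /quad; have := sqr_ge0 (x - d + (y - d)).
      by have := sqr_ge0 (x - d); have := sqr_ge0 (y - d); lra.
    by rewrite /quad; lra.
  rewrite !refill_lin refill_static//.
  have := refill_sqr_shift_le a1 a2 room; rewrite Sm.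
  by lra.
have exp i j d : `|psi1 i j d - psi2 i j d| <= M3 / 6 * psi3 i j d.
  have := difference_expansion w (a i - a p + d) (a j - a p + d) dg dg' dg'' g3M.
  have -> : w + (a i - a p + d) = W S + d + a i by rewrite /w; ring.
  have -> : w + (a j - a p + d) = W S + d + a j by rewrite /w; ring.
  have -> : a i - a p + d - (a j - a p + d) = a i - a j by ring.
  have -> : (a i - a p + d + (a j - a p + d)) / 2 = (a i + a j) / 2 - a p + d by field.
  by [].
rewrite -E2; apply: le_trans (_ : M3 / 6 * fill S psi3 <= _); last first.
  by rewrite ler_wpM2l// divr_ge0.
rewrite ler_norml; apply/andP; split.
  rewrite lerBrDl -mulNr -refill_lin; apply: refill_le => // i j d.
  by have := exp i j d; rewrite ler_norml => /andP[? _]; rewrite -/(psi1 i j d); lra.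
rewrite lerBlDl -refill_lin; apply: refill_le => // i j d.
by have := exp i j d; rewrite ler_norml => /andP[_ ?]; rewrite -/(psi1 i j d); lra.
Qed.

(** The expansions are averaged over (S, p).  Given the set p |: S, every element
    is equally likely to be p, so a_p may be replaced by W / n; this is the only
    use of the conditioning on the sample as a set, and it produces the term
    with sampling_variance in mean_shift_scale. *)
Lemma sampling_stein_bound :
  `|\sum_(S : {set I} | #|S| == m.+1) (s2 * g' (W S) - W S * g (W S))|
  <= Cn * (s2 * M2 * Num.sqrt mean_shift_scale
           + s2 * M3 / (12 * N) * (52 * N * p4 + 180)).
Proof.
have M30 : 0 <= M3 by apply: le_trans (g3M 0).
have M20 : 0 <= M2 by apply: le_trans (g2M 0).
have s2p := s20; have L0p := L0; have Np := N0; have np : 0 < n by rewrite ltr0n.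
have Cn0 : 0 <= Cn by exact: ler0n.
pose EE (F : {set I} -> I -> R) :=
  \sum_(S : {set I} | #|S| == m) \sum_(p | p \notin S) F S p.
pose w S p := W S + a p.
have wU S p : p \notin S -> w S p = W (p |: S).
  by move=> pS; rewrite /w sum_U1// addrC.
have EEb (u : R -> R) : EE (fun S p => u (w S p))
    = n * \sum_(S : {set I} | #|S| == m.+1) u (W S).
  by apply: (@sum_after_last _ (fun S => u (W S))) => S p pS; rewrite wU.
have EED F G : EE (fun S p => F S p + G S p) = EE F + EE G.
  by rewrite /EE -big_split/=; apply: eq_bigr => S _; rewrite -big_split.
have EEZ F (c : R) : EE (fun S p => c * F S p) = c * EE F.
  rewrite /EE mulr_sumr; apply: eq_bigr => S _; by rewrite mulr_sumr.
have EE_eq F G : (forall S p, #|S| = m -> p \notin S -> F S p = G S p) ->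
    EE F = EE G.
  by move=> E; apply: eq_bigr => S /eqP Sm; apply: eq_bigr => p pS; exact: E.
have EE_le F G : (forall S p, #|S| = m -> p \notin S -> F S p <= G S p) ->
    EE F <= EE G.
  by move=> E; apply: ler_sum => S /eqP Sm; apply: ler_sum => p pS; exact: E.
have EE_abs F : `|EE F| <= EE (fun S p => `|F S p|).
  apply: le_trans (ler_norm_sum _ _ _) _; apply: ler_sum => S _.
  exact: ler_norm_sum.
have EE_cst (c : R) : EE (fun _ _ => c) = n * Cn * c.
  by rewrite /EE (sum_before_last (fun=> c)) sum_subset_cst mulrA CnE.
pose ref S := fill S
  (fun i j d => (a i - a j) * (g (W S + d + a i) - g (W S + d + a j))).
pose P := mean_shift.
pose c := s2 / (2 * N).
have c0 : 0 < c by rewrite divr_gt0// mulr_gt0.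
pose D S p := 2 * N * (g' (w S p) + g'' (w S p) * (P S - a p)) - ref S.
pose K S p := g'' (w S p) * (P S - n^-1 * w S p).
(* given the set p |: S, the added element p is uniform in it *)
have Ea : EE (fun S p => g'' (w S p) * a p)
    = EE (fun S p => g'' (w S p) * (n^-1 * w S p)).
  rewrite (EEb (fun x => g'' x * (n^-1 * x))) mulr_sumr.
  rewrite /EE (sum_add_remove m (fun S p => g'' (w S p) * a p)).
  apply: eq_bigr => S _.
  rewrite (eq_bigr (fun p => g'' (W S) * a p)).
    by rewrite -mulr_sumr mulrCA mulVKf// gt_eqF.
  by move=> p pS; rewrite /w sum_D1// subrK.
have main : n * \sum_(S : {set I} | #|S| == m.+1) (s2 * g' (W S) - W S * g (W S))
   = c * EE D - s2 * EE K.
  rewrite sumrB mulrBr -sum_refill_stein -/(EE (fun S _ => ref S)) -/c.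
  rewrite -mulr_sumr mulrCA -EEb.
  have EK : EE K = EE (fun S p => g'' (w S p) * P S)
      - EE (fun S p => g'' (w S p) * a p).
    rewrite Ea -mulN1r -EEZ -EED; apply: EE_eq => S p _ _; rewrite /K; ring.
  have -> : EE D = 2 * N * (EE (fun S p => g' (w S p)) + EE K)
      - EE (fun S _ => ref S).
    transitivity (EE (fun S p => 2 * N * (g' (w S p) + (g'' (w S p) * P S +
        (-1) * (g'' (w S p) * a p))) + (-1) * ref S)).
      by apply: EE_eq => S p _ _; rewrite /D; ring.
    by rewrite EED !EEZ !EED !EEZ EK; ring.
  by rewrite /c; field; rewrite gt_eqF.
have bD : c * `|EE D| <= n * Cn * (s2 * M3 / (12 * N) * (52 * N * p4 + 180)).
  have : `|EE D| <= EE (fun S p => (M3 / 6 * (52 * N * p4 + 72))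
        + ((2 * M3 * N) * a p ^+ 2 + (16 * M3 * m%:R / (N - m%:R)) * (1 - \sum_(i in S) a i ^+ 2))).
    apply: le_trans (EE_abs _) _; apply: EE_le => S p Sm _.
    by rewrite /D distrC; apply: le_trans (refill_expansion p Sm) _; lra.
  rewrite !EED !EEZ EE_cst.
  have -> : EE (fun _ p => a p ^+ 2) = n * Cn / N.
    rewrite -sum_outside_sqr; apply: eq_bigr => S _.
    by rewrite (sum_notin S (fun p => a p ^+ 2)) a2.
  have -> : EE (fun S _ => 1 - \sum_(i in S) a i ^+ 2) = (N - m%:R) * (n * Cn / N).
    rewrite /EE (sum_before_last (fun S => 1 - \sum_(i in S) a i ^+ 2)).
    by rewrite sum_outside_sqr.
  move=> /(ler_wpM2l (ltW c0)) /le_trans; apply.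
  have -> : c * (M3 / 6 * (n * Cn * (52 * N * p4 + 72)) +
      (2 * M3 * N * (n * Cn / N)
       + 16 * M3 * m%:R / (N - m%:R) * ((N - m%:R) * (n * Cn / N))))
    = n * Cn * (s2 * M3 / (12 * N)) * (52 * N * p4 + 84 + 96 * (m%:R / N)).
    by rewrite /c; field; rewrite !gt_eqF.
  rewrite [leRHS]mulrA; apply: ler_wpM2l.
    apply: mulr_ge0; first by rewrite mulr_ge0 ?ler0n.
    apply: divr_ge0; first by apply: mulr_ge0 => //; exact: ltW.
    by apply: mulr_ge0 => //; exact: ltW.
  have : m%:R / N <= 1 by rewrite ler_pdivrMr// mul1r; lra.
  lra.
pose sc := mean_shift_scale.
pose rt := Num.sqrt sc.
have p60 : 0 <= p6 by apply: sumr_ge0 => i _; exact: exprn_even_ge0.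
have sc0 : 0 < sc.
  rewrite /sc /mean_shift_scale mulr_gt0//.
  have : 0 < s2 / (4 * n ^+ 2) by rewrite divr_gt0// mulr_gt0// exprn_gt0.
  have gm : 0 <= ga ^+ 2 * m%:R ^+ 2 by rewrite -exprMn sqr_ge0.
  have := sqr_ge0 be; have := sqr_ge0 et; have := mulr_ge0 p60 (sqr_ge0 al).
  move: gm; move: (p6 * al ^+ 2) (be ^+ 2) (et ^+ 2) (ga ^+ 2 * _) (s2 / _).
  by move=> x1 x2 x3 x4 x5; lra.
have rt0 : 0 < rt by rewrite sqrtr_gt0.
have rtE : rt ^+ 2 = sc by rewrite sqr_sqrtr// ltW.
have bK : `|EE K| <= n * Cn * (M2 * rt).
  have sq : EE (fun S p => (P S - n^-1 * w S p) ^+ 2) <= n * Cn * sc.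
    apply: (@le_trans _ _
      (EE (fun S p => 2 * P S ^+ 2 + (2 / n ^+ 2) * w S p ^+ 2))).
      apply: EE_le => S p _ _; have := sqr_ge0 (P S + n^-1 * w S p).
      by rewrite -exprVn; move: (P S) (w S p) n^-1 => x y z; lra.
    rewrite EED !EEZ (EEb (fun x => x ^+ 2)) sum_second_moment.
    rewrite /EE (sum_before_last (fun S => P S ^+ 2)).
    have := ler_wpM2l (ltW L0p) sum_mean_shift_sqr; rewrite -/P mulrCA -CnE => H.
    have -> : n * Cn * sc = 2 * (4 * (p6 * al ^+ 2 + be ^+ 2
          + ga ^+ 2 * m%:R ^+ 2 + et ^+ 2) * (n * Cn))
        + 2 / n ^+ 2 * (n * (Cn * s2)).
      by rewrite /sc /mean_shift_scale; field; rewrite gt_eqF.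
    by rewrite lerD2r ler_wpM2l.
  apply: le_trans (EE_abs _) _.
  (* Cauchy-Schwarz in the form |v| <= rt / 2 + v^2 / (2 rt) *)
  apply: (@le_trans _ _ (EE (fun S p => M2 * rt / 2
            + M2 / (2 * rt) * (P S - n^-1 * w S p) ^+ 2))).
    apply: EE_le => S p _ _; rewrite /K normrM; set v := P S - _.
    have -> : M2 * rt / 2 + M2 / (2 * rt) * v ^+ 2
      = M2 * (rt / 2 + v ^+ 2 / (2 * rt)).
      by field; rewrite gt_eqF.
    apply: ler_pM => //.
    have -> : rt / 2 + v ^+ 2 / (2 * rt) = `|v| + (rt - `|v|) ^+ 2 / (2 * rt).
      by rewrite -(real_normK (num_real v)); field; rewrite gt_eqF.
    by rewrite lerDl divr_ge0 ?sqr_ge0// mulr_ge0// ltW.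
  rewrite EED (EEZ (fun S p => (P S - n^-1 * w S p) ^+ 2)) EE_cst.
  have : M2 / (2 * rt) * EE (fun S p => (P S - n^-1 * w S p) ^+ 2)
      <= M2 / (2 * rt) * (n * Cn * sc).
    by apply: ler_wpM2l => //; rewrite divr_ge0// mulr_ge0// ltW.
  have -> : M2 / (2 * rt) * (n * Cn * sc) = n * Cn * (M2 * rt / 2).
    by rewrite -rtE; field; rewrite gt_eqF.
  lra.
rewrite -(ler_pM2l np) -{1}(gtr0_norm np) -normrM main.
apply: le_trans (ler_normB _ _) _.
rewrite (normrM c) (gtr0_norm c0) (normrM s2) (gtr0_norm s2p).
have := ler_wpM2l (ltW s2p) bK; rewrite -/rt; lra.
Qed.

End test_function.

End sampling_bound.

(** * The law of a simple random sample *)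

Section sampling_law.
Local Open Scope classical_set_scope.
Local Open Scope ring_scope.
Context {R : realType}.

Lemma expectation_finite_valued (d : measure_display) (T : measurableType d)
    (P : probability T R) (F : finType) (J : T -> F) (phi : F -> R) :
  (forall s, measurable (J @^-1` [set s])) ->
  ('E_P[fun t => phi (J t)] = (\sum_s phi s * fine (P (J @^-1` [set s])))%:E)%E.
Proof.
move=> mJ; rewrite unlock.
transitivity (\int[P]_t (\sum_s (phi s)%:E * (\1_(J @^-1` [set s]) t)%:E))%E.
  apply: eq_integral => t _; rewrite (bigD1 (J t))//= big1 ?adde0.
    by rewrite indicE mem_set// mule1.
  move=> s sJ; rewrite indicE memNset ?mule0// => /= E.
  by rewrite E eqxx in sJ.
rewrite integral_sum//; last first.
  by move=> s; apply: integrableZl => //; exact: integrable_indic.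
rewrite -sumEFin; apply: eq_bigr => s _.
rewrite integralZl//; last exact: integrable_indic.
by rewrite integral_indic// setIT EFinM fineK// fin_num_measure.
Qed.

Lemma sum_injective_ffun (N n : nat) (u : {set 'I_N} -> R) :
  \sum_(s : {ffun 'I_n -> 'I_N} | injectiveb s) u [set s i | i in 'I_n]%SET
  = n`!%:R * \sum_(S : {set 'I_N} | #|S| == n) u S.
Proof.
rewrite (partition_big (fun s : {ffun 'I_n -> 'I_N} => [set s i | i in 'I_n]%SET)
  (fun S => #|S| == n))/=; last first.
  by move=> s /injectiveP sI; rewrite card_imset// card_ord.
rewrite mulr_sumr; apply: eq_bigr => S /eqP Sn.
rewrite (eq_bigr (fun=> u S)); last by move=> s /andP[_ /eqP ->].
rewrite sumr_const mulr_natl; congr (_ *+ _).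
have := card_inj_ffuns_on 'I_n (mem S); rewrite Sn card_ord ffactnn => <-.
apply: eq_card => s; rewrite unfold_in /= inE [RHS]andbC.
apply: andb_id2l => /injectiveP sI.
apply/eqP/ffun_onP => [<- i|sS]; first exact: imset_f.
apply/eqP; rewrite eqEcard card_imset// card_ord Sn leqnn andbT.
by apply/fintype.subsetP => x /imsetP[i _ ->]; exact: sS.
Qed.

(** The injective index vectors carry total mass one, so the others are null; a
    set of size n is the image of n! of them. *)
Lemma expectation_sample_sum (N n : nat) (a : 'I_N -> R)
    (d : measure_display) (T : measurableType d) (P : probability T R)
    (X : 'I_n -> {RV P >-> R}) (u : R -> R) :
  (n <= N)%N -> simple_random_sample a X ->
  ('E_P[fun t => u (sample_sum X t)]
   = ('C(N, n)%:R^-1 * \sum_(S : {set 'I_N} | #|S| == n) u (\sum_(i in S) a i))%:E)%E.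
Proof.
move=> nN [J [mJ PJ XJ]].
pose q (s : {ffun 'I_n -> 'I_N}) := fine (P (J @^-1` [set s])).
have q0 s : 0 <= q s by rewrite fine_ge0.
have qinj (s : {ffun 'I_n -> 'I_N}) : injectiveb s -> q s = (N ^_ n)%:R^-1.
  by move=> /injectiveP sI; rewrite /q PJ.
have cardinj : \sum_(s : {ffun 'I_n -> 'I_N} | injectiveb s) (1 : R) = (N ^_ n)%:R.
  rewrite sumr_const; congr (_ *+ _).
  have := card_inj_ffuns 'I_n 'I_N; rewrite !card_ord => <-.
  by apply: eq_card => s; rewrite !inE.
have fact0 : (N ^_ n)%:R != 0 :> R by rewrite pnatr_eq0 -lt0n ffact_gt0.
have qT : \sum_s q s = 1.
  have := expectation_finite_valued P (fun=> 1) mJ.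
  rewrite (expectation_cst P 1) => -[E]; rewrite [RHS]E.
  by apply: eq_bigr => s _; rewrite mul1r.
have qN (s : {ffun 'I_n -> 'I_N}) : ~~ injectiveb s -> q s = 0.
  have : \sum_(s : {ffun 'I_n -> 'I_N} | ~~ injectiveb s) q s = 0.
    move: qT; rewrite (bigID (fun s : {ffun 'I_n -> 'I_N} => injectiveb s))/=.
    rewrite (eq_bigr (fun=> (N ^_ n)%:R^-1 * 1)); last first.
      by move=> s' /qinj; rewrite mulr1.
    by rewrite -mulr_sumr cardinj mulVf// => H; apply: (addrI 1); rewrite H addr0.
  by move=> /psumr_eq0P H sN; apply: H.
pose phi (s : {ffun 'I_n -> 'I_N}) := u (\sum_i a (s i)).
have -> : (fun t => u (sample_sum X t)) = (fun t => phi (J t)).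
  by apply/funext => t; rewrite /sample_sum /phi; under eq_bigr do rewrite XJ.
rewrite (expectation_finite_valued P phi mJ); congr EFin.
rewrite (bigID (fun s : {ffun 'I_n -> 'I_N} => injectiveb s))/=.
rewrite [X in _ + X]big1 ?addr0; last first.
  by move=> s /qN; rewrite /q => ->; rewrite mulr0.
rewrite (eq_bigr (fun s : {ffun 'I_n -> 'I_N} => (N ^_ n)%:R^-1 *
    (fun S : {set 'I_N} => u (\sum_(i in S) a i)) [set s i | i in 'I_n]%SET));
  last first.
  move=> s sI; rewrite -/(q s) qinj// mulrC; congr (_ * u _).
  by rewrite big_imset//=; move=> i j _ _; apply/injectiveP.
rewrite -mulr_sumr.
rewrite (sum_injective_ffun n (fun S : {set 'I_N} => u (\sum_(i in S) a i))).
rewrite mulrA; congr (_ * _).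
by rewrite -bin_ffact natrM invfM -mulrA mulVf ?mulr1.
Qed.

End sampling_law.

(** * Normal approximation for a fixed population *)

Section finite_bound.
Local Open Scope classical_set_scope.
Local Open Scope ring_scope.
Context {R : realType} (N n : nat) (a : 'I_N -> R)
  (d : measure_display) (T : measurableType d) (P : probability T R)
  (X : 'I_n -> {RV P >-> R}).
Hypotheses (nN : (0 < n < N)%N) (a1 : power_sum a 1 = 0)
  (a3 : power_sum a 3 = 0) (a2 : power_sum a 2 = 1)
  (srs : simple_random_sample a X).

Let nN1 : (n.-1.+1 < #|'I_N|)%N.
Proof. by case/andP: nN => n0 nN'; rewrite card_ord prednK. Qed.

Let binom0 : ('C(N, n)%:R : R) != 0.
Proof. by case/andP: nN => _ nN'; rewrite pnatr_eq0 -lt0n bin_gt0 ltnW. Qed.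

Lemma sigma_sqr : sigma R N n ^+ 2 = sampling_variance (I := 'I_N) n.-1.
Proof.
case/andP: nN => n0 nN'; rewrite /sigma /sampling_variance card_ord prednK//.
have nN2 : (n%:R : R) + 1 <= N%:R by rewrite natr1 ler_nat.
have n1 : (1 : R) <= n%:R by rewrite ler1n.
by rewrite sqr_sqrtr// divr_ge0// mulr_ge0//; lra.
Qed.

Lemma sigma_gt0 : 0 < sigma R N n.
Proof.
case/andP: nN => n0 nN'; rewrite /sigma sqrtr_gt0.
have nN2 : (n%:R : R) + 1 <= N%:R by rewrite natr1 ler_nat.
have n1 : (1 : R) <= n%:R by rewrite ler1n.
by rewrite divr_gt0// mulr_gt0//; lra.
Qed.

Lemma sample_variance :
  ('E_P[fun t => (sample_sum X t ^+ 2)%R] = ((sigma R N n ^+ 2)%R)%:E)%E.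
Proof.
case/andP: (nN) => n0 nN'.
rewrite (expectation_sample_sum (fun x => x ^+ 2) (ltnW nN') srs).
have := sum_second_moment a1 a2 nN1; rewrite card_ord prednK// => ->.
by rewrite mulKf// sigma_sqr.
Qed.

Lemma C1_scale : C1 n a = Num.sqrt (mean_shift_scale a n.-1).
Proof.
case/andP: nN => n0 nN'.
rewrite /C1 /mean_shift_scale /power_sum -sqrtrM// card_ord prednK// -sigma_sqr.
have -> : n.-1%:R = n%:R - 1 :> R by rewrite -subn1 natrB.
by rewrite -!addrA.
Qed.

(** Stein's bound is applied to g w = F (w / s) / s, for which
    s^2 g' w - w g w = h (w / s) - Phi h. *)
Lemma normal_approximation (h : R -> R) : four_bounded_derivatives h ->
  (`| 'E_P[fun t => h (sample_sum X t / sigma R N n)%R] - Phi h |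
    <= ((3 * sigma R N n)^-1 * C1 n a * sup_norm (h^`(3))%classic
        + (8 * sigma R N n ^+ 2)^-1 * C2 a * sup_norm (h^`(4))%classic)%:E)%E.
Proof.
move=> hb; have [c [F [F1 [F2 [F3 [PhiE [dF dF1 dF2] eqF F2b F3b]]]]]] := stein_equation hb.
case/andP: (nN) => n0 nN'.
set s := sigma R N n; have s0 : 0 < s := sigma_gt0.
have s00 : s != 0 by rewrite gt_eqF.
rewrite (expectation_sample_sum (fun x => h (x / s)) (ltnW nN') srs) PhiE.
rewrite -EFinB abse_EFin lee_fin.
set W := fun S : {set 'I_N} => \sum_(i in S) a i.
have dscale (u u' : R -> R) (k l : R) : (forall t : R, is_derive t 1 u (u' t)) ->
    k / s = l ->
    forall t : R, is_derive t 1 (fun t => k * u (t / s)) (l * u' (t / s)).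
  move=> du kl t.
  have d1 : is_derive t 1 (fun t : R => t / s) s^-1.
    by apply: is_derive_eq; rewrite /GRing.scale/=; ring.
  have d2 := @is_derive1_comp _ u (fun t : R => t / s) t _ _ (du (t / s)) d1.
  by apply: is_derive_eq; rewrite /GRing.scale/= -kl; ring.
have bscale (u : R -> R) (k l : R) : 0 <= k -> (forall t, `|u t| <= l) ->
    forall t, `|k * u (t / s)| <= k * l.
  by move=> k0 ul t; rewrite normrM (ger0_norm k0) ler_wpM2l.
have e1 : s^-1 / s = s ^- 2 by field.
have e2 : s ^- 2 / s = s ^- 3 by field.
have e3 : s ^- 3 / s = s ^- 4 by field.
have k3 : 0 <= s ^- 3 by rewrite invr_ge0 exprn_ge0// ltW.
have k4 : 0 <= s ^- 4 by rewrite invr_ge0 exprn_ge0// ltW.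
have := sampling_stein_bound a1 a2 a3 nN1 (dscale _ _ _ _ dF e1)
  (dscale _ _ _ _ dF1 e2) (dscale _ _ _ _ dF2 e3)
  (bscale _ _ _ k3 F2b) (bscale _ _ _ k4 F3b).
rewrite card_ord prednK// -C1_scale -sigma_sqr -/s.
have -> : \sum_(S : {set 'I_N} | #|S| == n)
    (s ^+ 2 * (s ^- 2 * F1 ((\sum_(i in S) a i) / s))
     - (\sum_(i in S) a i) * (s^-1 * F ((\sum_(i in S) a i) / s)))
   = 'C(N, n)%:R *
     ('C(N, n)%:R^-1 * \sum_(S : {set 'I_N} | #|S| == n) h (W S / s) - c).
  rewrite mulrBr mulrA divff// mul1r -[in 'C(N, n)%:R * c](card_ord N).
  rewrite -sum_subset_cst -sumrB.
  apply: eq_bigr => S _; rewrite -eqF -/(W S); field.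
  exact: s00.
rewrite normrM ger0_norm// ler_pM2l; last by rewrite lt0r binom0 ler0n.
move=> /le_trans; apply; apply: lerD.
  by rewrite le_eqVlt; apply/orP; left; apply/eqP; field.
rewrite /C2 /power_sum; set s4 := sup_norm _; set p4 := \sum_i _.
have s40 : 0 <= s4 by case: hb => _ bh; apply: sup_norm_ge0; exact: bh.
have p40 : 0 <= p4 by apply: sumr_ge0 => i _; exact: exprn_even_ge0.
have N0 : 0 < N%:R :> R by rewrite ltr0n (leq_ltn_trans _ nN').
have iN0 : 0 <= N%:R^-1 :> R by rewrite invr_ge0 ltW.
have -> : s ^+ 2 * (s ^- 4 * (s4 / 4)) / (12 * N%:R) * (52 * N%:R * p4 + 180)
   = (8 * s ^+ 2)^-1 * s4 * (26 / 3 * p4 + 30 / N%:R).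
  by field; rewrite s00 gt_eqF.
rewrite [leRHS]mulrAC; apply: ler_wpM2l; last by lra.
by rewrite mulr_ge0// invr_ge0 mulr_ge0 ?sqr_ge0.
Qed.

End finite_bound.

(** * Asymptotic constants *)

Section asymptotics.
Local Open Scope classical_set_scope.
Local Open Scope ring_scope.
Context {R : realType}.
Variable f : R.
Implicit Types (x t : R).

(** The definitions below express sigma^2, alpha, n beta, n (n - 1) gamma and
    n eta through x = n / N and t = 1 / n; at t = 0 and x = f they take the values
    f (1 - f), -1, - f / (1 - f), 0 and - f / (1 - f). *)
Definition sigma2_xt x t := x * (1 - x) / (1 - x * t).
Definition alpha_xt x t := (1 - t) * x * x * t / (1 - x) - 1.
Definition beta_xt x t :=
  - 2 * x * ((1 - t) * x / (1 - x + x * t)) + x * ((1 - 3 * t) * x / (1 - x)) - x.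
Definition gamma_xt x t :=
  - 2 * x * ((1 - t) * x / (1 - x + x * t)) * (x * t / (1 - x)).
Definition eta_xt x t := x * (- 1 + 3 * (x * t)) / (1 - x).
Definition rest_xt x t :=
  beta_xt x t * beta_xt x t + gamma_xt x t * gamma_xt x t + eta_xt x t * eta_xt x t.

Let q := f * (1 - f).
Let v := 2 * (f / (1 - f)) ^+ 2.

(** ratio3 bounds the squared ratio of the h''' constant to its asymptotic value,
    and ratio4 the ratio of the h'''' constant to its asymptotic value. *)
Definition ratio3 x t :=
  (1 + `|sigma2_xt x t / q - 1| + `|alpha_xt x t * alpha_xt x t - 1|
   + `|rest_xt x t / v - 1|)
  * (q / sigma2_xt x t).
Definition ratio4 x t := (1 + `|x / f - 1|) * (q / sigma2_xt x t).
Definition error_xt x t := `|ratio3 x t - 1| + `|ratio4 x t - 1|.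

Lemma parameters_xt (N n : nat) : (0 < n < N)%N ->
  let x := n%:R / N%:R in let t := n%:R^-1 in
  [/\ sigma R N n ^+ 2 = sigma2_xt x t,
      alpha R N n = alpha_xt x t,
      n%:R * beta R N n = beta_xt x t,
      n%:R * (gamma R N n * (n%:R - 1)) = gamma_xt x t &
      n%:R * eta R N n = eta_xt x t].
Proof.
move=> /andP[n0 nN] x t.
have n1 : 1 <= n%:R :> R by rewrite ler1n.
have nN1 : n%:R + 1 <= N%:R :> R by rewrite natr1 ler_nat.
rewrite /sigma sqr_sqrtr; last by rewrite divr_ge0// mulr_ge0//; lra.
rewrite /sigma2_xt /alpha_xt /beta_xt /gamma_xt /eta_xt.
rewrite /alpha /beta /gamma /eta /x /t.
move: (n%:R : R) (N%:R : R) n1 nN1 => m M m1 mM.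
have e0 : M != 0 by rewrite gt_eqF//; lra.
have e1 : m != 0 by rewrite gt_eqF//; lra.
have e2 : M - 1 != 0 by rewrite gt_eqF//; lra.
have e3 : M - m != 0 by rewrite gt_eqF//; lra.
have e4 : M - m + 1 != 0 by rewrite gt_eqF//; lra.
split.
- by field; rewrite ?e0 ?e1 ?e2 ?e3 ?e4.
- by field; rewrite ?e0 ?e1 ?e2 ?e3 ?e4.
- by field; rewrite ?e0 ?e1 ?e2 ?e3 ?e4.
- by field; rewrite ?e0 ?e1 ?e2 ?e3 ?e4.
- by field; rewrite ?e0 ?e1 ?e2 ?e3 ?e4.
Qed.

Hypothesis f01 : 0 < f < 1.

Let q0 : 0 < q. Proof. by case/andP: f01 => ? ?; rewrite mulr_gt0//; lra. Qed.
Let v0 : 0 < v.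
Proof. by case/andP: f01 => ? ?; rewrite mulr_gt0// exprn_gt0// divr_gt0//; lra. Qed.

Section limit.
Variables (x t : nat -> R).
Hypotheses (xf : x @ \oo --> f) (t0 : t @ \oo --> (0 : R)).

Let limM (u w : nat -> R) (l m : R) : u @ \oo --> l -> w @ \oo --> m ->
  (fun k => u k * w k) @ \oo --> l * m.
Proof. exact: cvgM. Qed.
Let limD (u w : nat -> R) (l m : R) : u @ \oo --> l -> w @ \oo --> m ->
  (fun k => u k + w k) @ \oo --> l + m.
Proof. exact: cvgD. Qed.
Let limN (u : nat -> R) (l : R) : u @ \oo --> l -> (fun k => - u k) @ \oo --> - l.
Proof. exact: cvgN. Qed.
Let limV (u : nat -> R) (l : R) : l != 0 -> u @ \oo --> l ->
  (fun k => (u k)^-1) @ \oo --> l^-1.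
Proof. exact: cvgV. Qed.
Let lim_norm (u : nat -> R) (l : R) : u @ \oo --> l ->
  (fun k => `|u k|) @ \oo --> `|l|.
Proof. exact: cvg_norm. Qed.
Let lim_cst (c : R) : (fun _ : nat => c) @ \oo --> c.
Proof. exact: cvg_cst. Qed.

Ltac lim := repeat first [exact: xf | exact: t0 | exact: lim_cst | apply: limM
  | apply: limD | apply: limN | apply: limV | apply: lim_norm].

Lemma cvg_error_xt : (fun k => error_xt (x k) (t k)) @ \oo --> (0 : R).
Proof.
have [f0 f1] := andP f01.
have s0 : sigma2_xt f 0 = q by rewrite /sigma2_xt mulr0 subr0 divr1.
have r0 : rest_xt f 0 = v.
  rewrite /rest_xt /beta_xt /gamma_xt /eta_xt /v; field.
  by rewrite gt_eqF//; lra.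
have a0 : alpha_xt f 0 = -1 by rewrite /alpha_xt mulr0 mul0r sub0r.
suff : (fun k => error_xt (x k) (t k)) @ \oo --> error_xt f 0.
  rewrite /error_xt /ratio3 /ratio4 s0 r0 a0 mulN1r opprK !divff ?gt_eqF//.
  by rewrite subrr normr0 !addr0 !mulr1 subrr normr0 addr0.
have sx : (fun k => sigma2_xt (x k) (t k)) @ \oo --> sigma2_xt f 0.
  by rewrite /sigma2_xt; lim; rewrite mulr0 subr0 oner_neq0.
have ax : (fun k => alpha_xt (x k) (t k)) @ \oo --> alpha_xt f 0.
  by rewrite /alpha_xt; lim; rewrite gt_eqF//; lra.
have bx : (fun k => beta_xt (x k) (t k)) @ \oo --> beta_xt f 0.
  by rewrite /beta_xt; lim; rewrite gt_eqF//; lra.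
have gx : (fun k => gamma_xt (x k) (t k)) @ \oo --> gamma_xt f 0.
  by rewrite /gamma_xt; lim; rewrite gt_eqF//; lra.
have ex : (fun k => eta_xt (x k) (t k)) @ \oo --> eta_xt f 0.
  by rewrite /eta_xt; lim; rewrite gt_eqF//; lra.
have rx : (fun k => rest_xt (x k) (t k)) @ \oo --> rest_xt f 0.
  by rewrite /rest_xt; apply: limD; [apply: limD|]; exact: limM.
have sV : (fun k => q / sigma2_xt (x k) (t k)) @ \oo --> q / sigma2_xt f 0.
  by apply: limM; [exact: lim_cst|apply: limV => //; rewrite s0 gt_eqF].
rewrite /error_xt; apply: limD; apply: lim_norm; apply: limD; try exact: lim_cst.
- rewrite /ratio3; apply: limM => //; apply: limD; [apply: limD; [apply: limD|]|].
  + exact: lim_cst.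
  + by apply: lim_norm; apply: limD; [apply: limM => //|]; exact: lim_cst.
  + by apply: lim_norm; apply: limD; [exact: limM|exact: lim_cst].
  + by apply: lim_norm; apply: limD; [apply: limM => //|]; exact: lim_cst.
- rewrite /ratio4; apply: limM => //; apply: limD; first exact: lim_cst.
  by apply: lim_norm; apply: limD; [apply: limM => //|]; exact: lim_cst.
Qed.

End limit.

Lemma le_relative_error (y y0 : R) : 0 < y0 -> y <= y0 * (1 + `|y / y0 - 1|).
Proof.
move=> y00; rewrite mulrC -ler_pdivrMr//.
by have := ler_norm (y / y0 - 1); lra.
Qed.

(** Under the root, each term is at most its limit times 1 plus the relative
    errors; then sqrt r <= 1 + |r - 1| for r = ratio3. *)
Lemma C1_le_B1 (N n : nat) (a : 'I_N -> R) : (0 < n < N)%N ->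
  (3 * sigma R N n)^-1 * C1 n a
  <= n%:R^-1 * B1 n f a * (1 + error_xt (n%:R / N%:R) n%:R^-1).
Proof.
move=> nN; set e := error_xt _ _; have [es ea eb eg ee] := parameters_xt nN.
set x := n%:R / N%:R in e es ea eb eg ee *; set t := n%:R^-1 in e es ea eb eg ee *.
have s0 := @sigma_gt0 R N n nN.
set s := sigma R N n in es s0 *.
have n0 : 0 < n%:R :> R by case/andP: nN => ? _; rewrite ltr0n.
rewrite /C1 /B1 -/q -/v -/s.
set A := (X in Num.sqrt 8 * Num.sqrt X); set X0 := (X in _ * Num.sqrt X / _).
pose p6 := power_sum a 6.
have p60 : 0 <= p6 by apply: sumr_ge0 => i _; exact: exprn_even_ge0.
pose rho := 1 + `|sigma2_xt x t / q - 1|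
  + `|alpha_xt x t * alpha_xt x t - 1| + `|rest_xt x t / v - 1|.
have n2p6 : 0 <= n%:R ^+ 2 * p6 by rewrite mulr_ge0// exprn_ge0// ltW.
have X00 : 0 < X0 by rewrite /X0 -/p6; have := q0; have := v0; lra.
have A_le : n%:R ^+ 2 * A <= rho * X0.
  have -> : n%:R ^+ 2 * A = s ^+ 2 / 4
      + n%:R ^+ 2 * p6 * (alpha_xt x t * alpha_xt x t) + rest_xt x t.
    rewrite /rest_xt -eb -eg -ee -ea /A -/p6; field.
    by rewrite gt_eqF.
  have := le_relative_error (sigma2_xt x t) q0; rewrite -es.
  have := le_relative_error (rest_xt x t) v0.
  have : alpha_xt x t * alpha_xt x t <= 1 + `|alpha_xt x t * alpha_xt x t - 1|.
    by have := ler_norm (alpha_xt x t * alpha_xt x t - 1); lra.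
  move=> /(ler_wpM2l n2p6).
  rewrite /X0 /rho -/p6 -es; move: (rest_xt x t) (alpha_xt x t * _) => r al.
  have := mulr_ge0 n2p6 (normr_ge0 (s ^+ 2 / q - 1)).
  have := mulr_ge0 n2p6 (normr_ge0 (r / v - 1)).
  have := mulr_ge0 (ltW q0) (normr_ge0 (al - 1)).
  have := mulr_ge0 (ltW q0) (normr_ge0 (r / v - 1)).
  have := mulr_ge0 (ltW v0) (normr_ge0 (al - 1)).
  have := mulr_ge0 (ltW v0) (normr_ge0 (s ^+ 2 / q - 1)).
  move: (`|s ^+ 2 / q - 1|) (`|r / v - 1|) (`|al - 1|) => y1 y2 y3.
  move: (n%:R ^+ 2 * p6) => Z.
  lra.
have e3 : ratio3 x t <= (1 + e) ^+ 2.
  have e1 : ratio3 x t <= 1 + e.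
    rewrite /e /error_xt; have := ler_norm (ratio3 x t - 1).
    by have := normr_ge0 (ratio4 x t - 1); lra.
  have e0 : 0 <= e by rewrite addr_ge0.
  have := sqr_ge0 e; lra.
have e0 : 0 <= e by rewrite addr_ge0.
pose Z := s / n%:R * (Num.sqrt X0 / Num.sqrt q) * (1 + e).
have Z0 : 0 <= Z.
  by rewrite !mulr_ge0 ?invr_ge0 ?sqrtr_ge0 ?addr_ge0// ltW.
have AZ : Num.sqrt A <= Z.
  rewrite -(ger0_norm Z0) -sqrtr_sqr ler_sqrt ?sqr_ge0// /Z.
  rewrite -(ler_pM2l (exprn_gt0 2 n0)); apply: le_trans A_le _.
  have -> : n%:R ^+ 2 * (s / n%:R * (Num.sqrt X0 / Num.sqrt q) * (1 + e)) ^+ 2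
    = s ^+ 2 * (Num.sqrt X0 ^+ 2 / Num.sqrt q ^+ 2) * (1 + e) ^+ 2.
    by field; rewrite !gt_eqF// sqrtr_gt0.
  rewrite (sqr_sqrtr (ltW X00)) (sqr_sqrtr (ltW q0)).
  have c0 : 0 <= s ^+ 2 * (X0 / q) by rewrite mulr_ge0 ?sqr_ge0// divr_ge0// ltW.
  apply: le_trans _ (ler_wpM2l c0 e3).
  rewrite /ratio3 -/rho -es le_eqVlt; apply/orP; left; apply/eqP; field.
  by rewrite !gt_eqF.
have -> : n%:R^-1 * (Num.sqrt 8 / 3 * Num.sqrt X0 / Num.sqrt q) * (1 + e)
  = (3 * s)^-1 * (Num.sqrt 8 * Z).
  by rewrite /Z; field; rewrite !gt_eqF// sqrtr_gt0.
apply: ler_wpM2l; first by rewrite invr_ge0 mulr_ge0// ltW.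
by apply: ler_wpM2l; first exact: sqrtr_ge0.
Qed.

Lemma C2_le_B2 (N n : nat) (a : 'I_N -> R) : (0 < n < N)%N ->
  (8 * sigma R N n ^+ 2)^-1 * C2 a
  <= n%:R^-1 * B2 n f a * (1 + error_xt (n%:R / N%:R) n%:R^-1).
Proof.
move=> nN; set e := error_xt _ _; have [es _ _ _ _] := parameters_xt nN.
set x := n%:R / N%:R in e es *; set t := n%:R^-1 in e es *.
have s0 := @sigma_gt0 R N n nN.
set s := sigma R N n in es s0 *.
have n0 : 0 < n%:R :> R by case/andP: nN => ? _; rewrite ltr0n.
have N0 : 0 < N%:R :> R.
  by case/andP: nN => ? ?; rewrite ltr0n (ltn_trans _ (_ : n < N)%N).
have [f0 _] := andP f01.
rewrite /C2 /B2 -/q; set p4 := power_sum a 4.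
have p40 : 0 <= p4 by apply: sumr_ge0 => i _; exact: exprn_even_ge0.
have e1 : ratio4 x t <= 1 + e.
  rewrite /e /error_xt; have := ler_norm (ratio4 x t - 1).
  by have := normr_ge0 (ratio3 x t - 1); lra.
pose Y0 := 11 * n%:R * p4 + 45 * f.
have Y00 : 0 <= Y0 by rewrite /Y0 addr_ge0 ?mulr_ge0// ltW.
have Y_le : 11 * n%:R * p4 + 45 * x <= Y0 * (1 + `|x / f - 1|).
  have := le_relative_error x f0.
  have : 0 <= n%:R * p4 * `|x / f - 1| by rewrite !mulr_ge0// ltW.
  by rewrite /Y0; lra.
have -> : (8 * s ^+ 2)^-1 * (11 * p4 + 45 / N%:R)
  = (8 * s ^+ 2)^-1 * n%:R^-1 * (11 * n%:R * p4 + 45 * x).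
  by rewrite /x; field; rewrite !gt_eqF.
have c1 : 0 <= (8 * s ^+ 2)^-1 * n%:R^-1.
  by rewrite mulr_ge0// invr_ge0 ?mulr_ge0 ?sqr_ge0// ltW.
apply: le_trans (ler_wpM2l c1 Y_le) _.
have c2 : 0 <= n%:R^-1 * (8^-1 * Y0 / q).
  by rewrite !mulr_ge0 ?invr_ge0// ltW.
apply: le_trans _ (ler_wpM2l c2 e1).
rewrite /ratio4 -es le_eqVlt; apply/orP; left; apply/eqP; field.
by rewrite !gt_eqF.
Qed.

End asymptotics.

(** * Normal approximation for simple random samples *)

Unset Implicit Arguments.
Set Strict Implicit.

Local Open Scope classical_set_scope.
Local Open Scope ring_scope.

Theorem theorem4p1 (R : realType) :
  (forall (N n : nat) (a : 'I_N -> R)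
      (d : measure_display) (T : measurableType d) (P : probability T R)
      (X : 'I_n -> {RV P >-> R}),
    (0 < n < N)%N ->
    power_sum a 1 = 0 -> power_sum a 3 = 0 -> power_sum a 2 = 1 ->
    simple_random_sample a X ->
    ('E_P[fun t => (sample_sum X t ^+ 2)%R] = ((sigma R N n ^+ 2)%R)%:E)%E /\
    (forall h : R -> R, four_bounded_derivatives h ->
      (`| 'E_P[fun t => h (sample_sum X t / sigma R N n)%R] - Phi h |
        <= ((3 * sigma R N n)^-1 * C1 n a * sup_norm (h^`(3))%classic
            + (8 * sigma R N n ^+ 2)^-1 * C2 a * sup_norm (h^`(4))%classic)%:E)%E)) /\
  (forall (f : R) (N n : nat -> nat) (a : forall k, 'I_(N k) -> R)
      (d : nat -> measure_display) (T : forall k, measurableType (d k))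
      (P : forall k, probability (T k) R)
      (X : forall k, 'I_(n k) -> {RV (P k) >-> R}),
    0 < f < 1 ->
    (forall k, (0 < n k < N k)%N) ->
    n @ \oo --> \oo ->
    ((n k)%:R / (N k)%:R : R) @[k --> \oo] --> f ->
    (forall k, [/\ power_sum (a k) 1 = 0, power_sum (a k) 3 = 0
                 & power_sum (a k) 2 = 1]) ->
    (forall k, simple_random_sample (a k) (X k)) ->
    exists eps : nat -> R,
      eps @ \oo --> (0 : R) /\
      (forall h : R -> R, four_bounded_derivatives h -> forall k : nat,
        (`| 'E_(P k)[fun t => h (sample_sum (X k) t / sigma R (N k) (n k))%R]
            - Phi h |
          <= ((n k)%:R^-1 * (B1 (n k) f (a k) * sup_norm (h^`(3))%classic
                             + B2 (n k) f (a k) * sup_norm (h^`(4))%classic)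
              * (1 + eps k))%:E)%E)).
Proof.
split.
  move=> N n a d T P X nN a1 a3 a2 srs; split; first exact: sample_variance srs.
  exact: normal_approximation.
move=> f N n a d T P X f01 nN noo nNf aP srs.
exists (fun k => error_xt f ((n k)%:R / (N k)%:R) (n k)%:R^-1); split.
  apply: (cvg_error_xt f01 (x := fun k => (n k)%:R / (N k)%:R)
    (t := fun k => (n k)%:R^-1)); first exact: nNf.
  have noo' : ((n k)%:R : R) @[k --> \oo] --> +oo := cvg_comp _ _ noo cvgr_idn.
  by apply/gtr0_cvgV0 => //; apply: nearW => k; rewrite ltr0n; case/andP: (nN k).
move=> h hb k; have [a1 a3 a2] := aP k; have [_ bh] := hb.
have h3 : 0 <= sup_norm (h^`(3))%classic by apply: sup_norm_ge0; exact: bh.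
have h4 : 0 <= sup_norm (h^`(4))%classic by apply: sup_norm_ge0; exact: bh.
apply: le_trans (normal_approximation (nN k) a1 a3 a2 (srs k) hb) _.
have distr (y b1 b2 x3 x4 e : R) : y * (b1 * x3 + b2 * x4) * (1 + e)
    = y * b1 * (1 + e) * x3 + y * b2 * (1 + e) * x4 by ring.
rewrite lee_fin distr; apply: lerD.
- apply: (ler_wpM2r h3); exact: C1_le_B1.
- apply: (ler_wpM2r h4); exact: C2_le_B2.
Qed.
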